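(* Let $(X,\sigma_X)$, $(Y,\sigma_Y)$ be one-sided subshifts, $\pi:X\to Y$ a one-block factor map, and suppose $X$ has the specification property. Let $\mathcal F=\{\log f_n\}$ be an almost additive potential on $X$ with bounded variation, $\mu$ its unique invariant Gibbs measure (which is its unique equilibrium state), and $\nu=\pi\mu$. Then $P_Y(\tilde{\mathcal G})=0$, $\nu$ is the unique invariant Gibbs measure for $\tilde{\mathcal G}=\{\log\tilde g_n\}$ on $Y$, and $\nu$ is the unique equilibrium state for $\tilde{\mathcal G}$.
   Context: Subshifts: one-sided closed shift-invariant subsets of $\{1,\dots,k\}^{\mathbb N}$ with shift and metric $d(x,x')=2^{-j}$, $j$ the longest common prefix length. Specification: $\exists p>0$ such that for all allowable $u,v$ there is $w$ of length $p$ with $uwv$ allowable. Factor map: continuous surjection commuting with shifts, one-block. Almost additive: $\exists C>0$, $e^{-C}f_n(x)f_m(\sigma^nx)\le f_{n+m}(x)\le e^Cf_n(x)f_m(\sigma^nx)$; bounded variation: $\sup_n\sup\{f_n(x)/f_n(x'):x_i=x'_i,1\le i\le n\}<\infty$. Pressure of a sequence $\Phi=\{\log\phi_n\}$: $P(\Phi)=\lim_{\epsilon\to0}\limsup_n\frac1n\log\sup_E\sum_{x\in E}\phi_n(x)$ over $(n,\epsilon)$-separated sets. Gibbs measure for $\Phi$: $\exists C_0$ with $C_0^{-1}<\mu([x_1\cdots x_n])/(e^{-nP(\Phi)}\phi_n(x))<C_0$ for all $x,n$. Equilibrium state: invariant measure maximizing $h_\mu+\lim_n\frac1n\int\log\phi_nd\mu$.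 $E_n(y)$: any set with exactly one point from each cylinder $[x_1\cdots x_n]$ of $X$ with $\pi([x_1\cdots x_n])\subseteq[y_1\cdots y_n]$; $g_n(y)=\sup_{E_n(y)}\sum_{x\in E_n(y)}f_n(x)$; $\tilde g_n=g_ne^{-nP_X(\mathcal F)}$. *)

(* Defs.v *)
From HB Require Import structures.
From mathcomp Require Import all_boot all_order all_algebra.
From mathcomp Require Import all_classical all_reals all_analysis.
Set Implicit Arguments. Unset Strict Implicit. Unset Printing Implicit Defensive.
Import Order.TTheory GRing.Theory Num.Theory.
Local Open Scope classical_set_scope.
Local Open Scope ring_scope.

(** One-sided sequences over the alphabet 'I_k.+1 (a nonempty finite alphabet
    of size k+1); positions are indexed from 0. *)
Definition shsp (k : nat) : Type := nat -> 'I_k.+1.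
HB.instance Definition _ k := Choice.copy (shsp k) (nat -> 'I_k.+1).
HB.instance Definition _ k := isPointed.Build (shsp k) (fun _ => ord0).

Definition sshift {k} (x : shsp k) : shsp k := fun i => x i.+1.

Definition cyl {k} (n : nat) (x : shsp k) : set (shsp k) :=
  [set z | forall i, (i < n)%N -> z i = x i].

(** Borel sigma-algebra of the sshift space = the one generated by cylinders. *)
Definition cylinders (k : nat) : set (set (shsp k)) :=
  [set A | exists n x, A = cyl n x].
Notation shspace k := (g_sigma_algebraType (@cylinders k)).

Definition sdist {R : realType} {k} (x y : shsp k) : R :=
  match pselect (exists j, x j != y j) with
  | left H => (2^-1) ^+ (ex_minn H)
  | right _ => 0
  end.

Definition bowen {R : realType} {k} (n : nat) (x y : shsp k) : R :=
  \big[Num.max/0]_(i < n) sdist (iter i sshift x) (iter i sshift y).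

Definition nsep {R : realType} {k} (X : set (shsp k)) (n : nat) (eps : R)
    (E : set (shsp k)) : Prop :=
  E `<=` X /\ forall x y, E x -> E y -> x <> y -> eps < bowen n x y.

(** One-sided subshift: closed (in the metric d) and sshift-invariant. *)
Definition subshift {k} (X : set (shsp k)) : Prop :=
  (forall x, (forall n, exists2 y, X y & forall i, (i < n)%N -> y i = x i) -> X x)
  /\ (forall x, X x -> X (sshift x)).

Definition allowable {k} (X : set (shsp k)) (u : seq 'I_k.+1) : Prop :=
  exists2 x, X x & exists j, forall i, (i < size u)%N -> Some (x (j + i)%N) = onth u i.

Definition specification {k} (X : set (shsp k)) : Prop :=
  exists2 p, (0 < p)%N & forall u v, allowable X u -> allowable X v ->
    exists w, size w = p /\ allowable X (u ++ w ++ v).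

Definition one_block {k l} (phi : 'I_k.+1 -> 'I_l.+1) (x : shsp k) : shsp l :=
  fun i => phi (x i).
Definition one_block_factor {k l} (X : set (shsp k)) (Y : set (shsp l))
    (phi : 'I_k.+1 -> 'I_l.+1) : Prop :=
  (forall x, X x -> Y (one_block phi x)) /\
  (forall y, Y y -> exists2 x, X x & one_block phi x = y).

(** Sequences of functions f_n (n >= 1); Phi = {log f_n}. *)
Definition potseq (R : realType) k := nat -> shsp k -> R.

Definition cont_on {R : realType} {k} (X : set (shsp k)) (g : shsp k -> R) : Prop :=
  forall x, X x -> forall e : R, 0 < e -> exists m, forall y, X y ->
    (forall i, (i < m)%N -> y i = x i) -> `|g y - g x| < e.

Definition almost_additive {R : realType} {k} (X : set (shsp k)) (f : potseq R k) : Prop :=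
  (forall n, (0 < n)%N -> forall x, X x -> 0 < f n x) /\
  (forall n, (0 < n)%N -> cont_on X (f n)) /\
  exists2 C : R, 0 < C & forall n m, (0 < n)%N -> (0 < m)%N -> forall x, X x ->
    expR (- C) * f n x * f m (iter n sshift x) <= f (n + m)%N x /\
    f (n + m)%N x <= expR C * f n x * f m (iter n sshift x).

Definition bdd_variation {R : realType} {k} (X : set (shsp k)) (f : potseq R k) : Prop :=
  exists M : R, forall n, (0 < n)%N -> forall x x', X x -> X x' ->
    (forall i, (i < n)%N -> x i = x' i) -> f n x <= M * f n x'.

Definition elog {R : realType} (a : \bar R) : \bar R :=
  match a with
  | r%:E => if (0 < r)%R then (ln r)%:E else -oo
  | +oo => +oo
  | -oo => -oo
  end%E.

Definition sepsum {R : realType} {k} (X : set (shsp k)) (phi : potseq R k)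
    (n : nat) (eps : R) : \bar R :=
  ereal_sup [set (\sum_(x \in E) phi n x)%:E |
             E in [set E | finite_set E /\ nsep X n eps E]].

Definition pressure {R : realType} {k} (X : set (shsp k)) (phi : potseq R k) : \bar R :=
  lim ((fun eps : R =>
        limn_esup (fun n => ((n%:R)^-1)%:E * elog (sepsum X phi n eps))%E)
       x @[x --> 0^'+]).

Definition invariant_on {R : realType} {k} (X : set (shsp k))
    (m : probability (shspace k) R) : Prop :=
  m X = 1%E /\
  forall A : set (shspace k), measurable A -> m (@sshift k @^-1` A) = m A.

Definition gibbs {R : realType} {k} (X : set (shsp k)) (phi : potseq R k)
    (m : probability (shspace k) R) : Prop :=
  exists C0 : R, forall x, X x -> forall n, (0 < n)%N ->
    C0^-1 < fine (m (cyl n x)) / (expR (- (n%:R * fine (pressure X phi))) * phi n x)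
    < C0.

Definition entr {R : realType} (p : R) : R := - (p * ln p).

Definition mpartition {k} r (xi : 'I_r -> set (shspace k)) : Prop :=
  (forall i, measurable (xi i)) /\
  (forall i j, i != j -> xi i `&` xi j = set0) /\
  (forall x, exists i, xi i x).

(** H(xi v sigma^{-1} xi v ... v sigma^{-(n-1)} xi). *)
Definition joinH {R : realType} {k} (m : probability (shspace k) R) r
    (xi : 'I_r -> set (shspace k)) (n : nat) : R :=
  \sum_(t : {ffun 'I_n -> 'I_r})
    entr (fine (m [set x | forall i : 'I_n, xi (t i) (iter i (@sshift k) x)])).

Definition entropy_part {R : realType} {k} (m : probability (shspace k) R) r
    (xi : 'I_r -> set (shspace k)) : \bar R :=
  lim ((((n%:R)^-1 * joinH m xi n)%:E) @[n --> \oo]).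

Definition entropy {R : realType} {k} (m : probability (shspace k) R) : \bar R :=
  ereal_sup [set e | exists r (xi : 'I_r -> set (shspace k)),
                      mpartition xi /\ e = entropy_part m xi].

Definition pot_integral {R : realType} {k} (X : set (shsp k)) (phi : potseq R k)
    (m : probability (shspace k) R) : \bar R :=
  lim ((((n%:R)^-1)%:E * \int[m]_(x in (X : set (shspace k))) (ln (phi n x))%:E)%E
       @[n --> \oo]).

Definition equilibrium {R : realType} {k} (X : set (shsp k)) (phi : potseq R k)
    (m : probability (shspace k) R) : Prop :=
  invariant_on X m /\
  forall m' : probability (shspace k) R, invariant_on X m' ->
    (entropy m' + pot_integral X phi m' <= entropy m + pot_integral X phi m)%E.

Definition same_measure {R : realType} {k} (m m' : probability (shspace k) R) : Prop :=
  forall A : set (shspace k), measurable A -> m A = m' A.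

(** E_n(y): exactly one point from each cylinder [x_1..x_n] of X whose image
    under the one-block map lies in [y_1..y_n]. *)
Definition En {k l} (X : set (shsp k)) (phi : 'I_k.+1 -> 'I_l.+1) (n : nat)
    (y : shsp l) (E : set (shsp k)) : Prop :=
  E `<=` [set x | X x /\ forall i, (i < n)%N -> phi (x i) = y i] /\
  forall x, X x -> (forall i, (i < n)%N -> phi (x i) = y i) ->
    exists x', [/\ E x', (forall i, (i < n)%N -> x' i = x i) &
      forall x'', E x'' -> (forall i, (i < n)%N -> x'' i = x i) -> x'' = x'].

Definition gseq {R : realType} {k l} (X : set (shsp k)) (phi : 'I_k.+1 -> 'I_l.+1)
    (f : potseq R k) : potseq R l :=
  fun n y => sup [set \sum_(x \in E) f n x | E in En X phi n y].

Definition gtilde {R : realType} {k l} (X : set (shsp k)) (phi : 'I_k.+1 -> 'I_l.+1)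
    (f : potseq R k) : potseq R l :=
  fun n y => gseq X phi f n y * expR (- (n%:R * fine (pressure X f))).

(* Main.v *)
Require Import Defs.
From HB Require Import structures.
From mathcomp Require Import all_boot all_order all_algebra.
From mathcomp Require Import all_classical all_reals all_analysis.
From mathcomp Require Import lra ring.
Import Order.TTheory GRing.Theory Num.Theory.
Import numFieldNormedType.Exports.
Local Open Scope classical_set_scope.
Local Open Scope ring_scope.

Set Implicit Arguments.
Unset Strict Implicit.
Unset Printing Implicit Defensive.

(** The Gibbs inequalities for [mu], summed over the words of [X] above a word
    of [Y], make [nu [y_1..y_n]] comparable to [gtilde n y] with uniform
    constants; this yields the zero pressure and the Gibbs property. Almost
    additivity makes [mu], hence [nu], quasi-submultiplicative on cylinders.

    For an invariant [m] on [Y] let [D_n] be the relative entropy of [m] with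
    respect to [nu] on words of length [n]. Then [h(m) + pot(m)] is the limit of
    [- D_n / n], so it is at most [0], with equality for [nu]. By subadditivity
    (Fekete), equality for [m] forces [D_n]
    to be bounded, and so does the Gibbs property of [m]. Bounded [D_n] implies
    that [m] is absolutely continuous with respect to [nu], and the ergodicity of
    [nu] then gives [m = nu]. Ergodicity follows from the uniqueness of [mu]: if
    [B] is an invariant set, the normalization of [mu + mu(. `&` B)] is again an
    invariant Gibbs measure, hence equals [mu], so [mu B] is [0] or [1]. *)

(** The obstacle is that almost additivity does not descend through the factor map. A preimage of a
    concatenated word of [Y] splits into preimages of its two pieces, but two such preimages need
    not concatenate in [X]. So only the upper inequality for [nu] on cylinders is carried down, and
    the argument on [Y] rests on it, together with an exponential lower bound that keeps the
    logarithms of cylinder masses under control.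

    One side suffices because Shannon entropy is subadditive too: [ln K - D_n] is a subadditive
    sequence, and Fekete's limit is an infimum, so [L * n <= ln K - D_n] at every [n]. Hence [L = 0]
    gives [D_n <= ln K], where a mere limit would only give [D_n = o(n)].

    Since [entropy] is a supremum over all finite measurable partitions, reading it off words takes
    a form of the Kolmogorov-Sinai theorem, obtained here by perturbing itineraries. *)

Section finite_valued.

(** * Laws and expectations of finite-valued maps *)

Context d (T : measurableType d) (R : realType).
Implicit Types (m : probability T R) (I J : finType).

Definition pr m (A : set T) : R := fine (m A).

Definition fmeas I (g : T -> I) : Prop :=
  forall i, measurable (g @^-1` [set i]).

Definition law m I (g : T -> I) (i : I) : R := pr m (g @^-1` [set i]).

Definition expect m I (g : T -> I) (F : I -> R) : R :=
  \sum_i law m g i * F i.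

Definition shannon m I (g : T -> I) : R := \sum_i entr (law m g i).

Lemma prE m A : measurable A -> (pr m A)%:E = m A.
Proof. by move=> mA; rewrite /pr fineK// fin_num_measure. Qed.

Lemma pr_ge0 m A : 0 <= pr m A.
Proof. exact: fine_ge0. Qed.

Lemma pr_le1 m A : measurable A -> pr m A <= 1.
Proof. by move=> mA; rewrite -lee_fin prE// probability_le1. Qed.

Lemma pr_setT m : pr m setT = 1.
Proof. by rewrite /pr probability_setT. Qed.

Lemma le_pr m A B : measurable A -> measurable B -> A `<=` B ->
  pr m A <= pr m B.
Proof.
by move=> mA mB AB; rewrite -lee_fin !prE// le_measure// inE.
Qed.

Lemma prU m A B : measurable A -> measurable B -> A `&` B = set0 ->
  pr m (A `|` B) = pr m A + pr m B.
Proof.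
move=> mA mB AB; apply: EFin_inj; rewrite EFinD !prE//; last exact: measurableU.
by rewrite measureU.
Qed.

Lemma prD m A B : measurable A -> measurable B -> A `<=` B ->
  pr m (B `\` A) = pr m B - pr m A.
Proof.
move=> mA mB AB; apply/eqP; rewrite eq_sym subr_eq addrC; apply/eqP.
rewrite -[in LHS](setDUK AB) prU//; first exact: measurableD.
by rewrite setDE setICA setICr setI0.
Qed.

Lemma prC m A : measurable A -> pr m (~` A) = 1 - pr m A.
Proof. by move=> mA; rewrite -setTD prD// pr_setT. Qed.

Lemma fmeas_preimage I (g : T -> I) (P : set I) :
  fmeas g -> measurable [set x | P (g x)].
Proof.
move=> mg; have -> : [set x | P (g x)] = \bigcup_(i in P) (g @^-1` [set i]).
  by apply/seteqP; split => [x Px|x [i Pi gx]]; [exists (g x)|rewrite /= gx].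
by apply: fin_bigcup_measurable => // i _; exact: mg.
Qed.

Lemma fmeas_pair I J (g : T -> I) (h : T -> J) :
  fmeas g -> fmeas h -> fmeas (fun x => (g x, h x)).
Proof.
move=> mg mh [i j].
rewrite [X in measurable X](_ : _ = (g @^-1` [set i]) `&` (h @^-1` [set j])).
  exact: measurableI.
by apply/seteqP; split => x /= [-> ->].
Qed.

Lemma law_ge0 m I (g : T -> I) i : 0 <= law m g i.
Proof. exact: pr_ge0. Qed.

Lemma pr_preimage m I (g : T -> I) (P : pred I) : fmeas g ->
  pr m [set x | P (g x)] = \sum_(i | P i) law m g i.
Proof.
move=> mg; apply: EFin_inj; rewrite prE; last exact: (fmeas_preimage [set` P]).
have -> : [set x | P (g x)] = \bigcup_(i in [set` P]) (g @^-1` [set i]).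
  by apply/seteqP; split => [x Px|x [i Pi gx]]; [exists (g x)|rewrite /= gx].
rewrite measure_fin_bigcup//; last first.
  by move=> i j _ _ [x /= [<- <-]].
rewrite -sumEFin [RHS]bigfs ?index_enum_uniq//; last first.
  by move=> i _ /negP[]; rewrite mem_index_enum.
by apply: eq_fsbigr => i _; rewrite /law prE.
Qed.

Lemma law_sum1 m I (g : T -> I) : fmeas g -> \sum_i law m g i = 1.
Proof.
by move=> mg; rewrite -(pr_preimage m xpredT mg) -[RHS](pr_setT m); congr (pr m _); apply/seteqP.
Qed.

Lemma law_le1 m I (g : T -> I) i : fmeas g -> law m g i <= 1.
Proof. by move=> mg; exact: pr_le1. Qed.

Lemma law_comp m I J (h : I -> J) (g : T -> I) j : fmeas g ->
  law m (h \o g) j = \sum_(i | h i == j) law m g i.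
Proof.
move=> mg; rewrite -pr_preimage//; congr (pr m _); apply/seteqP.
by split => x /= /eqP.
Qed.

Lemma expect_comp m I J (h : I -> J) (g : T -> I) F : fmeas g ->
  expect m (h \o g) F = expect m g (F \o h).
Proof.
move=> mg; rewrite /expect (partition_big h xpredT)//=.
apply: eq_bigr => j _; rewrite law_comp// mulr_suml.
by apply: eq_bigr => i /eqP <-.
Qed.

Lemma expectD m I (g : T -> I) F G :
  expect m g (fun i => F i + G i) = expect m g F + expect m g G.
Proof. by rewrite -big_split; apply: eq_bigr => i _ /=; rewrite mulrDr. Qed.

Lemma expect_cst m I (g : T -> I) c : fmeas g -> expect m g (fun=> c) = c.
Proof. by move=> mg; rewrite /expect -mulr_suml law_sum1// mul1r. Qed.

Lemma le_expect m I (g : T -> I) F G : (forall i, 0 < law m g i -> F i <= G i) ->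
  expect m g F <= expect m g G.
Proof.
move=> FG; apply: ler_sum => i _; have := law_ge0 m g i.
rewrite le_eqVlt => /predU1P[<-|pi]; first by rewrite !mul0r.
by rewrite ler_pM2l// FG.
Qed.

Lemma shannonE m I (g : T -> I) :
  shannon m g = - expect m g (fun i => ln (law m g i)).
Proof. by rewrite /expect -sumrN. Qed.

End finite_valued.

(** * Gibbs' inequality *)

Section gibbs_inequality.
Context (R : realType).

(** This is [ln (1 + x) <= x] at [x = q / p - 1], multiplied by [p]. The side condition guards
    against the convention [ln 0 = 0]: at [q = 0] and [0 < p <= 1] the inequality would fail. *)
Lemma mul_ln_sub_le (p q : R) : 0 <= p -> 0 <= q -> (q = 0 -> p = 0) ->
  p * (ln q - ln p) <= q - p.
Proof.
rewrite le_eqVlt => /predU1P[<-|p0]; first by rewrite mul0r subr0.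
rewrite le_eqVlt => /predU1P[<- /(_ erefl) p0'|q0 _]; first by rewrite p0' ltxx in p0.
rewrite -ln_div ?posrE// -[leRHS](mulfVK (lt0r_neq0 p0)) mulrC ler_pM2r//.
rewrite mulrBl divff ?gt_eqF//.
have qp : 0 < q / p by exact: divr_gt0.
have /le_ln1Dx : -1 < q / p - 1 by lra.
by rewrite addrC subrK.
Qed.

(** The total masses stay in the bound because [q] need not be normalized: it will be a
    subprobability built from a kernel, or a law tilted by an exponential. *)
Lemma gibbs_ineq (I : finType) (p q : I -> R) :
  (forall i, 0 <= p i) -> (forall i, 0 <= q i) -> (forall i, q i = 0 -> p i = 0) ->
  \sum_i p i * ln (q i) <= \sum_i p i * ln (p i) + (\sum_i q i - \sum_i p i).
Proof.
move=> p0 q0 qp; rewrite -lerBlDl -!sumrB; apply: ler_sum => i _.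
by rewrite -mulrBr mul_ln_sub_le//; exact: qp.
Qed.

Lemma entr_ge0 (p : R) : 0 <= p <= 1 -> 0 <= entr p.
Proof. by case/andP => p0 p1; rewrite /entr oppr_ge0 mulr_ge0_le0// ln_le0. Qed.

End gibbs_inequality.

(** * Shannon entropy of finite-valued maps *)

Section shannon_theory.
Context d (T : measurableType d) (R : realType).
Implicit Types (m : probability T R) (I J : finType).

Lemma shannon_ge0 m I (g : T -> I) : fmeas g -> 0 <= shannon m g.
Proof.
by move=> mg; apply: sumr_ge0 => i _; rewrite entr_ge0// law_ge0 law_le1.
Qed.

Lemma shannon_le m I (g : T -> I) (q : I -> R) : fmeas g ->
  (forall i, 0 <= q i) -> (forall i, q i = 0 -> law m g i = 0) ->
  \sum_i q i <= 1 -> shannon m g <= - expect m g (fun i => ln (q i)).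
Proof.
move=> mg q0 qp q1; rewrite shannonE lerN2.
have := gibbs_ineq (law_ge0 m g) q0 qp; rewrite law_sum1// => h.
by apply: (le_trans h); rewrite gerDl subr_le0.
Qed.

Lemma shannon_comp m I J (h : I -> J) (g : T -> I) : fmeas g ->
  shannon m (h \o g) <= shannon m g.
Proof.
move=> mg; rewrite !shannonE lerN2 expect_comp//; apply: le_expect => i pi /=.
have le_p : law m g i <= law m (h \o g) (h i).
  by rewrite law_comp// (bigD1 i)//= lerDl sumr_ge0// => ? _; exact: law_ge0.
by rewrite ler_ln// posrE//; exact: lt_le_trans le_p.
Qed.

Lemma law_pair_le m I J (g : T -> I) (h : T -> J) i j : fmeas g -> fmeas h ->
  law m (fun x => (g x, h x)) (i, j) <= law m g i /\
  law m (fun x => (g x, h x)) (i, j) <= law m h j.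
Proof.
move=> mg mh; have mgh := fmeas_pair mg mh.
by split; apply: le_pr => // x /= [].
Qed.

Lemma expect_fst m I J (g : T -> I) (h : T -> J) F : fmeas g -> fmeas h ->
  expect m (fun x => (g x, h x)) (fun ij => F ij.1) = expect m g F.
Proof. by move=> mg mh; rewrite -(expect_comp m fst F (fmeas_pair mg mh)). Qed.

Lemma expect_snd m I J (g : T -> I) (h : T -> J) F : fmeas g -> fmeas h ->
  expect m (fun x => (g x, h x)) (fun ij => F ij.2) = expect m h F.
Proof. by move=> mg mh; rewrite -(expect_comp m snd F (fmeas_pair mg mh)). Qed.

(* Both subadditivity ([a] constant in [j]) and the comparison of itineraries
   ([a] a product of Markov kernels) are instances of this. *)
Lemma shannon_pair_le m I J (g : T -> I) (h : T -> J) (a : J -> I -> R) :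
  fmeas g -> fmeas h -> (forall j i, 0 <= a j i) -> (forall j, \sum_i a j i <= 1) ->
  (forall i j, a j i = 0 -> law m (fun x => (g x, h x)) (i, j) = 0) ->
  shannon m (fun x => (g x, h x)) <=
  shannon m h - expect m (fun x => (g x, h x)) (fun ij => ln (a ij.2 ij.1)).
Proof.
move=> mg mh a0 a1 agh; have mgh := fmeas_pair mg mh.
(* The guess for the joint law is the law of [h] followed by the kernel [a], of total mass at most
   [1]. *)
apply: (@le_trans _ _ (- expect m (fun x => (g x, h x))
    (fun ij => ln (law m h ij.2 * a ij.2 ij.1)))).
  apply: shannon_le => //.
  - by move=> [i j]; rewrite mulr_ge0// law_ge0.
  - move=> [i j] /eqP; rewrite mulf_eq0 => /orP[] /eqP /= e; last exact: agh.
    apply/eqP; rewrite eq_le law_ge0 andbT -e.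
    by case: (law_pair_le m i j mg mh).
  - rewrite -(pair_bigA _ (fun i j => law m h j * a j i)) exchange_big/=.
    rewrite -(law_sum1 m mh); apply: ler_sum => j _.
    by rewrite -mulr_sumr ler_piMr// law_ge0.
rewrite shannonE -(expect_snd m (fun j => ln (law m h j)) mg mh).
rewrite -opprD -expectD lerN2; apply: le_expect => -[i j] pij /=.
rewrite lnM// posrE.
  by apply: (lt_le_trans pij); case: (law_pair_le m i j mg mh).
by rewrite lt_neqAle a0 andbT eq_sym; apply: contraTN pij => /eqP/agh ->; rewrite ltxx.
Qed.

Lemma shannon_pair m I J (g : T -> I) (h : T -> J) : fmeas g -> fmeas h ->
  shannon m (fun x => (g x, h x)) <= shannon m g + shannon m h.
Proof.
move=> mg mh.
have := @shannon_pair_le m I J g h (fun _ => law m g) mg mh.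
rewrite (shannonE m g) (expect_fst m (fun i => ln (law m g i)) mg mh) addrC; apply.
- by move=> _ i; exact: law_ge0.
- by move=> _; rewrite law_sum1.
- move=> i j e; apply/eqP; rewrite eq_le law_ge0 andbT -e.
  by case: (law_pair_le m i j mg mh).
Qed.

End shannon_theory.

(** The limit is the infimum of [u n / n] over positive [n], so the second conclusion holds at every
    length and not only asymptotically; it is what later bounds relative entropies. *)
Lemma fekete (R : realType) (u : nat -> R) (c : R) :
  (forall n m, (0 < n)%N -> (0 < m)%N -> u (n + m)%N <= u n + u m) ->
  (forall n, (0 < n)%N -> c * n%:R <= u n) ->
  exists L : R, ((n%:R)^-1 * u n @[n --> \oo] --> L) /\
    forall n, (0 < n)%N -> L * n%:R <= u n.
Proof.
move=> subu lbu; pose A := [set (n%:R)^-1 * u n | n in [set n | (0 < n)%N]].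
have lbA : lbound A c.
  by move=> _ [n /= n0 <-]; rewrite ler_pdivlMl ?ltr0n// mulrC lbu.
have hA : has_inf A by split; [exists (1%:R^-1 * u 1%N), 1%N|exists c].
have leL n : (0 < n)%N -> inf A <= (n%:R)^-1 * u n.
  by move=> n0; apply: ge_inf; [exists c|exists n].
exists (inf A); split; last first.
  by move=> n n0; rewrite mulrC -ler_pdivlMl ?ltr0n// leL.
apply/cvgrPdist_le => e e0.
have [_ [N /= N0 <-] aN] := inf_adherent (divr_gt0 e0 (ltr0n R 2)) hA.
(* [M] includes [|u 0|]: subadditivity is assumed at positive lengths only and does not control
   [u 0]. *)
pose M := \sum_(r < N) `|u r|.
have uM q r : (r < N)%N -> u (q * N + r)%N <= q%:R * u N + M.
  move=> rN; have urM : u r <= M.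
    rewrite /M (bigD1 (Ordinal rN))//= (le_trans (ler_norm _))//.
    by rewrite lerDl sumr_ge0.
  have M0 : 0 <= M by exact: sumr_ge0.
  elim: q => [|q IH]; first by rewrite mul0n mul0r add0r.
  rewrite mulSn -addnA -natr1 mulrDl mul1r.
  have [qr0|qr0] := posnP (q * N + r)%N; last first.
    by have := subu N _ N0 qr0; lra.
  move/eqP: (qr0); rewrite addn_eq0 muln_eq0 (gtn_eqF N0) orbF => /andP[/eqP q0 _].
  by rewrite qr0 addn0 q0 mul0r add0r lerDl.
have {}uM n : u n <= n%:R * ((N%:R)^-1 * u N) + (M + `|u N|).
  rewrite [in leLHS](divn_eq n N); apply: (le_trans (uM _ _ (ltn_pmod _ N0))).
  have NR : (N%:R : R) != 0 by rewrite pnatr_eq0 -lt0n.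
  have -> : (n %/ N)%:R * u N = (n%:R - (n %% N)%:R) * ((N%:R)^-1 * u N).
    by rewrite {2}(divn_eq n N) natrD addrK natrM mulrA mulfK.
  have : - ((n %% N)%:R * (N%:R^-1 * u N)) <= `|u N|.
    rewrite -mulrN -mulrN mulrA (le_trans (ler_norm _))// normrM normrN.
    rewrite ler_piMl// ger0_norm ?divr_ge0// ler_pdivrMr ?ltr0n// mul1r ler_nat.
    by rewrite ltnW// ltn_pmod.
  lra.
near=> n.
have n0 : (0 < n)%N by near: n; exists 1%N.
rewrite ler0_norm ?subr_le0 ?leL// opprB lerBlDr.
have nM : (e / 2)^-1 * (M + `|u N|) <= n%:R by near: n; exact: nbhs_infty_ger.
have := ler_wpM2l (ltW (divr_gt0 e0 (ltr0n R 2))) nM.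
rewrite mulrA divff ?gt_eqF ?divr_gt0// mul1r => {}nM.
have nR : (0 : R) < n%:R by rewrite ltr0n.
rewrite mulrC ler_pdivrMr//; apply: (le_trans (uM n)).
by have := ltW aN; rewrite -(ler_pM2l nR); nra.
Unshelve. all: by end_near.
Qed.

Lemma ln_prod (R : realType) (I : finType) (F : I -> R) : (forall i, 0 < F i) ->
  ln (\prod_i F i) = \sum_i ln (F i).
Proof.
move=> F0; suff [] : 0 < \prod_i F i /\ ln (\prod_i F i) = \sum_i ln (F i) by [].
elim/big_rec2: _ => [|i y x _ [x0 <-]]; first by rewrite ln1.
by rewrite mulr_gt0// lnM// posrE.
Qed.

(** * Itineraries under a measure-preserving map *)

Section itineraries.
Context d (T : measurableType d) (R : realType) (S : T -> T).
Hypothesis mS : forall A, measurable A -> measurable (S @^-1` A).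
Variable m : probability T R.
Hypothesis mI : forall A, measurable A -> m (S @^-1` A) = m A.
Implicit Types (I : finType).

Definition itin I (g : T -> I) n (x : T) : {ffun 'I_n -> I} :=
  [ffun i : 'I_n => g (iter i S x)].

Lemma fmeas_iter I (g : T -> I) n : fmeas g -> fmeas (g \o iter n S).
Proof.
move=> mg i; elim: n => [|n IH]; first exact: mg.
have -> : (g \o iter n.+1 S) @^-1` [set i] = S @^-1` ((g \o iter n S) @^-1` [set i]).
  by apply/seteqP; split => x /=; rewrite -iterSr.
exact: mS.
Qed.

Lemma law_iter I (g : T -> I) n i : fmeas g -> law m (g \o iter n S) i = law m g i.
Proof.
move=> mg; elim: n => [//|n <-]; rewrite /law /pr -[in RHS]mI; last exact: fmeas_iter.
by congr (fine (m _)); apply/seteqP; split => x /=; rewrite -iterSr.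
Qed.

Lemma expect_iter I (g : T -> I) n F : fmeas g ->
  expect m (g \o iter n S) F = expect m g F.
Proof. by move=> mg; apply: eq_bigr => i _; rewrite law_iter. Qed.

Lemma shannon_iter I (g : T -> I) n : fmeas g ->
  shannon m (g \o iter n S) = shannon m g.
Proof. by move=> mg; apply: eq_bigr => i _; rewrite law_iter. Qed.

Lemma fmeas_itin I (g : T -> I) n : fmeas g -> fmeas (itin g n).
Proof.
move=> mg t; have -> : itin g n @^-1` [set t] =
    \bigcap_(i in [set: 'I_n]) ((g \o iter i S) @^-1` [set t i]).
  apply/seteqP; split => [x /= <- i _|x /= h]; first by rewrite /= ffunE.
  by apply/ffunP => i; rewrite ffunE; exact: h.
by apply: fin_bigcap_measurable => // i _; exact: fmeas_iter.
Qed.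

Definition fcat I n p (uv : {ffun 'I_n -> I} * {ffun 'I_p -> I}) :
    {ffun 'I_(n + p) -> I} :=
  [ffun i : 'I_(n + p) => match fintype.split i with inl a => uv.1 a | inr b => uv.2 b end].

Lemma itin_cat I (g : T -> I) n p :
  itin g (n + p) = @fcat I n p \o (fun x => (itin g n x, itin g p (iter n S x))).
Proof.
apply/funext => x /=; apply/ffunP => i; rewrite !ffunE.
by case: split_ordP => j -> /=; rewrite ffunE//= addnC iterD.
Qed.

Lemma shannon_itin_subadd I (g : T -> I) n p : fmeas g ->
  shannon m (itin g (n + p)) <= shannon m (itin g n) + shannon m (itin g p).
Proof.
move=> mg; rewrite itin_cat.
have m1 := @fmeas_itin _ _ n mg; have m2 := @fmeas_itin _ _ p mg.
have m3 : fmeas (fun x => itin g p (iter n S x)) := @fmeas_iter _ _ n m2.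
apply: (le_trans (shannon_comp _ _ (fmeas_pair m1 m3))).
by apply: (le_trans (shannon_pair _ m1 m3)); rewrite (shannon_iter n m2).
Qed.

Lemma shannon_itin_cvg I (g : T -> I) : fmeas g ->
  exists L : R, ((n%:R)^-1 * shannon m (itin g n) @[n --> \oo] --> L) /\
    forall n, (0 < n)%N -> L * n%:R <= shannon m (itin g n).
Proof.
move=> mg; apply: (@fekete _ _ 0) => [n p _ _|n _].
  exact: shannon_itin_subadd.
by rewrite mul0r shannon_ge0//; exact: fmeas_itin.
Qed.

Lemma prod_kernel_sum_le1 I n (a : I -> I -> R) (s : {ffun 'I_n -> I}) :
  (forall i j, 0 <= a j i) -> (forall j, \sum_i a j i <= 1) ->
  \sum_(t : {ffun 'I_n -> I}) \prod_i a (s i) (t i) <= 1.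
Proof.
move=> a0 a1; rewrite -(bigA_distr_bigA (fun k i => a (s k) i)).
apply: prodr_ile1 => k _; rewrite a1 andbT.
by apply: sumr_ge0 => i _; exact: a0.
Qed.

(* Relative to the law of the [h]-itinerary, the [g]-itinerary is coded through
   the product kernel which keeps each symbol with probability [1 - e] and
   otherwise resamples it uniformly. *)
Lemma shannon_itin_perturb I (g h : T -> I) n (e : R) : fmeas g -> fmeas h ->
  0 < e < 1 ->
  shannon m (itin g n) <= shannon m (itin h n) +
    n%:R * (- ln (1 - e) - pr m [set x | g x != h x] * ln (e / #|I|%:R)).
Proof.
move=> mg mh /andP[e0 e1].
have I0 : T -> (0 : R) < #|I|%:R by move=> x; rewrite ltr0n; apply/card_gt0P; exists (g x).
have [x0|noT] := pselect (exists x : T, True); last first.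
  have T0 A : m A = 0.
    by rewrite (_ : A = set0) ?measure0//; apply/seteqP; split => // x; exfalso; apply: noT; exists x.
  by have := probability_setT m; rewrite T0 => /eqP; rewrite eqe eq_sym oner_eq0.
case: x0 => x0 _; move/(_ x0): I0 => I0.
pose a (j i : I) : R := (1 - e) * (i == j)%:R + e / #|I|%:R.
have eI : 0 < e / #|I|%:R by exact: divr_gt0.
have a0 j i : 0 < a j i.
  by rewrite /a; case: eqP => _; rewrite ?mulr1 ?mulr0 ?add0r// addr_gt0// subr_gt0.
have a1 j : \sum_i a j i <= 1.
  rewrite big_split/= -mulr_sumr sumr_const -[_ *+ _]mulr_natr.
  rewrite (bigD1 j)//= eqxx big1 => [|i /negbTE ->//].
  by rewrite addr0 mulr1 divfK ?subrK// gt_eqF.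
have mgn := @fmeas_itin _ _ n mg; have mhn := @fmeas_itin _ _ n mh.
have mgh := fmeas_pair mgn mhn.
have mgh1 := fmeas_pair mg mh.
rewrite (_ : itin g n = fst \o (fun x => (itin g n x, itin h n x)))//.
apply: (le_trans (shannon_comp _ _ mgh)).
pose b (s t : {ffun 'I_n -> I}) := \prod_i a (s i) (t i).
apply: (le_trans (@shannon_pair_le _ _ _ m _ _ _ _ b mgn mhn _ _ _)).
- by move=> s t; apply: prodr_ge0 => i _; exact: ltW.
- by move=> s; apply: prod_kernel_sum_le1 => // i j; exact: ltW.
- move=> t s /eqP; rewrite prodf_seq_eq0 => /hasP[i _]; by rewrite gt_eqF.
rewrite lerD2l; set c := (X in n%:R * X).
(* The logarithm of the product kernel is a sum over the [n] times, and by invariance all its terms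
   have the same expectation. *)
have -> : expect m (fun x => (itin g n x, itin h n x)) (fun ts => ln (b ts.2 ts.1)) =
    \sum_(i < n) expect m (fun x => (itin g n x, itin h n x))
      (fun ts => ln (a (ts.2 i) (ts.1 i))).
  rewrite /expect exchange_big/=; apply: eq_bigr => -[t s] _ /=.
  rewrite -mulr_sumr; congr (_ * _); rewrite /b.
  by rewrite ln_prod.
have -> : \sum_(i < n) expect m (fun x => (itin g n x, itin h n x))
      (fun ts => ln (a (ts.2 i) (ts.1 i))) = n%:R * expect m (fun x => (g x, h x)) (fun ij => ln (a ij.2 ij.1)).
  rewrite -[in n%:R](card_ord n) -sum1_card natr_sum mulr_suml; apply: eq_bigr => i _.
  rewrite mul1r -(expect_iter i _ mgh1).
  rewrite -(expect_comp m (fun ts : {ffun 'I_n -> I} * {ffun 'I_n -> I} => (ts.1 i, ts.2 i)) (fun ij => ln (a ij.2 ij.1)) mgh).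
  by congr (expect m _ _); apply/funext => x /=; rewrite !ffunE.
rewrite -mulrN ler_wpM2l// /c -opprD lerN2.
set D := pr _ _.
have -> : D = expect m (fun x => (g x, h x)) (fun ij => (ij.1 != ij.2)%:R).
  rewrite /D (pr_preimage m (fun ij : I * I => ij.1 != ij.2) mgh1) big_mkcond.
  by apply: eq_bigr => ij _; case: (_ != _); rewrite ?mulr1 ?mulr0.
(* Pointwise comparison: [a] is at least [1 - e] on the diagonal and equals [e / #|I|] off it, where
   the extra term [ln (1 - e)] is nonpositive. *)
rewrite -(expect_cst m (ln (1 - e)) mgh1) [X in _ + X]mulr_suml.
under [X in _ + X]eq_bigr do rewrite -mulrA.
rewrite -expectD; apply: le_expect => -[i j] _ /=; rewrite /a.
have e10 : 0 < 1 - e by rewrite subr_gt0.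
case: (eqVneq i j) => [_|_]; last first.
  by rewrite mul1r mulr0 add0r gerDr ln_le0// gerBl ltW.
rewrite mul0r addr0 mulr1 ler_ln ?posrE//; first by rewrite lerDl ltW.
by rewrite addr_gt0.
Qed.

End itineraries.

Notation shift k := (@sshift k : shspace k -> shspace k).

(** * Words, cylinders and local sets of the shift space *)

Section shift_space.
Context (R : realType) (k : nat).
Implicit Types (n : nat) (x y : shspace k) (m : probability (shspace k) R).

Definition agree n x y : Prop := forall i, (i < n)%N -> x i = y i.

Definition local n (C : set (shspace k)) : Prop :=
  forall x y, agree n x y -> C x -> C y.

Definition word n x : {ffun 'I_n -> 'I_k.+1} := [ffun i : 'I_n => x i].

(** A section of [word n], continuing by [ord0]. It lets functions of sequences be read as functions
    of words; [pad t] need not lie in the subshift. *)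
Definition pad n (t : {ffun 'I_n -> 'I_k.+1}) : shspace k :=
  fun i => if insub i is Some j then t j else ord0.

Lemma wordP n x y : word n x = word n y <-> agree n x y.
Proof.
split=> [e i ni|e]; first by have := congr1 (fun t : {ffun 'I_n -> 'I_k.+1} => t (Ordinal ni)) e; rewrite !ffunE.
by apply/ffunP => i; rewrite !ffunE e.
Qed.

Lemma agree_sym n x y : agree n x y -> agree n y x.
Proof. by move=> h i ni; rewrite h. Qed.

Lemma word_pad n (t : {ffun 'I_n -> 'I_k.+1}) : word n (pad t) = t.
Proof.
apply/ffunP => i; rewrite ffunE /pad insubT ?ltn_ord// => ni.
by congr (t _); apply: val_inj.
Qed.

Lemma agree_pad n x : agree n (pad (word n x)) x.
Proof. by apply/wordP; rewrite word_pad. Qed.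

Lemma cylE n x : cyl n x = word n @^-1` [set word n x].
Proof. by apply/seteqP; split => z /= /wordP. Qed.

Lemma measurable_cyl n x : measurable (cyl n x : set (shspace k)).
Proof. by apply: sub_sigma_algebra; exists n, x. Qed.

Lemma local_measurable n (C : set (shspace k)) : local n C -> measurable C.
Proof.
move=> lC; have -> : C = \bigcup_(t in [set t | C (@pad n t)]) cyl n (pad t).
  apply/seteqP; split => [x Cx|x [t /= Ct tx]].
    exists (word n x) => /=; last by apply: agree_sym; exact: agree_pad.
    by apply: lC Cx; apply: agree_sym; exact: agree_pad.
  by apply: lC Ct; exact: agree_sym.
by apply: fin_bigcup_measurable => // t _; exact: measurable_cyl.
Qed.

Lemma fmeas_local n (I : finType) (g : shspace k -> I) :
  (forall x y, agree n x y -> g x = g y) -> fmeas g.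
Proof. by move=> lg i; apply: (@local_measurable n) => x y xy /= <-; exact/esym/lg. Qed.

Lemma fmeas_word n : fmeas (word n).
Proof. by apply: (@fmeas_local n) => x y /wordP. Qed.

Lemma local_factor n (I : finType) (g : shspace k -> I) :
  (forall x y, agree n x y -> g x = g y) -> g = (fun t => g (pad t)) \o word n.
Proof. by move=> lg; apply/funext => x /=; apply: lg; apply: agree_sym; exact: agree_pad. Qed.

Lemma shspace_ind (P : set (shspace k) -> Prop) :
  (forall n x, P (cyl n x)) -> P set0 ->
  (forall A, P A -> P (~` A)) ->
  (forall F : (set (shspace k))^nat, (forall i, P (F i)) -> P (\bigcup_i F i)) ->
  forall A, measurable A -> P A.
Proof.
move=> Pcyl P0 PC PU; apply: smallest_sub; last by move=> _ [n [x ->]].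
by split => // A PA; rewrite setTD; exact: PC.
Qed.

Lemma measurable_sshift (A : set (shspace k)) :
  measurable A -> measurable (@sshift k @^-1` A : set (shspace k)).
Proof.
elim/shspace_ind => [n x| |B mB|F mF].
- apply: (@local_measurable n.+1) => y z yz /= xy i ni.
  by rewrite -xy// /sshift yz.
- by rewrite preimage_set0; exact: measurable0.
- by rewrite preimage_setC; exact: measurableC.
- by rewrite preimage_bigcup; exact: bigcup_measurable.
Qed.

Lemma iter_sshift n x i : iter n (@sshift k) x i = x (n + i)%N.
Proof. by elim: n i => [//|n IH] i; rewrite iterS /sshift IH addnS. Qed.

Lemma word_itin n : word n = itin (shift k) (fun x : shspace k => x 0%N) n.
Proof. by apply/funext => x; apply/ffunP => i; rewrite !ffunE iter_sshift addn0. Qed.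

Lemma fmeas_coord0 : fmeas (fun x : shspace k => x 0%N).
Proof. by apply: (@fmeas_local 1) => x y; apply. Qed.

End shift_space.

Section union_bounds.
Context (R : realType).

Definition symd (T : Type) (A B : set T) : set T := (A `\` B) `|` (B `\` A).

Lemma measurable_symd d (T : measurableType d) (A B : set T) :
  measurable A -> measurable B -> measurable (symd A B).
Proof. by move=> mA mB; apply: measurableU; exact: measurableD. Qed.

Lemma le_prU d (T : measurableType d) (P : probability T R) A B :
  measurable A -> measurable B -> pr P (A `|` B) <= pr P A + pr P B.
Proof.
move=> mA mB; rewrite -lee_fin EFinD !prE//; last exact: measurableU.
exact: measureU2.
Qed.

Lemma le_pr_bigU d (T : measurableType d) (P : probability T R) (I : finType)
    (r : seq I) (F : I -> set T) : (forall i, measurable (F i)) ->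
  pr P (\big[setU/set0]_(i <- r) F i) <= \sum_(i <- r) pr P (F i).
Proof.
move=> mF; elim: r => [|i r IH]; first by rewrite !big_nil /pr measure0.
rewrite !big_cons; apply: le_trans (lerD (lexx _) IH).
by apply: le_prU => //; exact: bigsetU_measurable.
Qed.

Lemma pr_bigcup_cvg d (T : measurableType d) (P : probability T R) (F : (set T)^nat) :
  (forall i, measurable (F i)) -> (forall i j, (i <= j)%N -> F i `<=` F j) ->
  pr P (F n) @[n --> \oo] --> pr P (\bigcup_i F i).
Proof.
move=> mF ndF; have mU : measurable (\bigcup_i F i) by exact: bigcup_measurable.
have nd : nondecreasing_seq F by move=> i j ij; apply/subsetPset; exact: ndF.
apply: fine_cvg; rewrite [X in _ --> X]prE//.
exact: (nondecreasing_cvg_mu (mu := P) mF mU nd).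
Qed.

End union_bounds.

(** * Approximation of measurable sets by local sets *)

Section approximation.
Context (R : realType) (k : nat).
Variable m : bool -> probability (shspace k) R.

(** One local set must serve both measures of the family: absolute continuity compares [m] and [nu]
    on the same approximant. *)
Definition approximable (A : set (shspace k)) : Prop :=
  measurable A /\ forall e : R, 0 < e -> exists n (C : set (shspace k)),
    local n C /\ forall b, pr (m b) (symd A C) <= e.

Lemma local_le n p (C : set (shspace k)) : (n <= p)%N -> local n C -> local p C.
Proof. by move=> np lC x y xy; apply: lC => i ni; apply: xy; exact: leq_trans np. Qed.

Lemma approximableU A B : approximable A -> approximable B -> approximable (A `|` B).
Proof.
move=> [mA hA] [mB hB]; split => [|e e0]; first exact: measurableU.
have [n [C [lC AC]]] := hA _ (divr_gt0 e0 (ltr0n R 2)).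
have [p [D [lD BD]]] := hB _ (divr_gt0 e0 (ltr0n R 2)).
have mC := local_measurable lC; have mD := local_measurable lD.
exists (maxn n p), (C `|` D); split => [x y xy [Cx|Dx]|b].
- by left; exact: (local_le (leq_maxl n p) lC xy).
- by right; exact: (local_le (leq_maxr n p) lD xy).
rewrite (splitr e); apply: le_trans (lerD (AC b) (BD b)).
have mAC := measurable_symd mA mC; have mBD := measurable_symd mB mD.
apply: le_trans (le_prU (m b) mAC mBD); apply: le_pr.
- by apply: measurable_symd; exact: measurableU.
- exact: measurableU.
- move=> x [[[Ax|Bx] /not_orP[nC nD]]|[[Cx|Dx] /not_orP[nA nB]]].
  + by left; left.
  + by right; left.
  + by left; right.
  + by right; right.
Qed.

Lemma measurable_approximable A : measurable A -> approximable A.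
Proof.
elim/shspace_ind => {A} [n x| |A [mA hA]|F aF].
- split=> [|e e0]; first exact: measurable_cyl.
  exists n, (cyl n x); split=> [y z yz xy i ni|b]; first by rewrite -xy// yz.
  by rewrite /symd setDv setU0 /pr measure0 ltW.
- split=> [|e e0]; first exact: measurable0.
  by exists 0%N, set0; split=> // b; rewrite /symd setDv setU0 /pr measure0 ltW.
- split=> [|e /hA[n [C [lC AC]]]]; first exact: measurableC.
  exists n, (~` C); split=> [x y xy nC Cy|b].
    by apply: nC; apply: lC Cy; exact: agree_sym.
  by rewrite /symd !setDE !setCK setIC setUC [_ `&` A]setIC -!setDE; exact: AC.
have mF i : measurable (F i) by case: (aF i).
pose B n := \big[setU/set0]_(i < n) F i.
have aB n : approximable (B n).
  elim: n => [|n IH]; last by rewrite /B big_ord_recr/=; exact: approximableU.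
  rewrite /B big_ord0; split=> [|e e0]; first exact: measurable0.
  by exists 0%N, set0; split=> // b; rewrite /symd setDv setU0 /pr measure0 ltW.
have mB n : measurable (B n) by case: (aB n).
have UB : \bigcup_i F i = \bigcup_n B n.
  rewrite /B; apply/seteqP; split => [x [i _ Fx]|x [n _]].
    by exists i.+1 => //; rewrite big_ord_recr/=; right.
  by rewrite -bigcup_mkord => -[i _ Fx]; exists i.
have mU : measurable (\bigcup_n B n) by exact: bigcup_measurable.
split=> [|e e0]; rewrite UB//.
have cB b := @pr_bigcup_cvg _ _ _ (m b) B mB (fun i j ij => subset_bigsetU (F:=F) ij).
have e2 : 0 < e / 2 by exact: divr_gt0.
(* Continuity from below gives a truncation for each measure; intersecting the two eventual
   conditions gives one [n] for both. *)
have [n hn] : exists n, forall b, pr (m b) ((\bigcup_n B n) `\` B n) <= e / 2.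
  have /cvgrPdist_le/(_ _ e2) c1 := cB true.
  have /cvgrPdist_le/(_ _ e2) c2 := cB false.
  have [n [h1 h2]] := filter_ex (filterI c1 c2).
  exists n => b; rewrite prD//; last by apply: bigcup_sup.
  by case: b; [apply: le_trans h1|apply: le_trans h2]; exact: ler_norm.
have [_ /(_ _ e2) [p [C [lC BC]]]] := aB n.
have mC := local_measurable lC.
exists p, C; split=> // b; rewrite (splitr e); apply: le_trans (lerD (hn b) (BC b)).
have m1 := measurableD mU (mB n); have m2 := measurable_symd (mB n) mC.
apply: le_trans (le_prU (m b) m1 m2); apply: le_pr.
- exact: measurable_symd.
- exact: measurableU.
move=> x [[Ux nC]|[Cx nU]].
  by have [Bx|nB] := pselect (B n x); [right; left|left].
by right; right; split=> // Bx; apply: nU; exists n.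
Qed.

End approximation.

(** * Entropy as the growth rate of word entropies *)

Section entropy_formula.
Context (R : realType) (k : nat) (m : probability (shspace k) R).
Hypothesis mI : forall A : set (shspace k), measurable A ->
  m (@sshift k @^-1` A) = m A.
Implicit Types I : finType.

(** Each fibre of [g] is approximated by a local set within [e / #|I|], and [h] picks an index whose
    local set contains the point. Outside the symmetric differences, of total mass at most [e], the
    only such index is [g x]. *)
Lemma local_approximation I (g : shspace k -> I) (e : R) : fmeas g -> 0 < e ->
  exists N (h : shspace k -> I), (forall x y, agree N x y -> h x = h y) /\
    pr m [set x | g x != h x] <= e.
Proof.
move=> mg e0; pose i0 := g (fun _ => ord0).
have I0 : 0 < #|I|%:R :> R by rewrite ltr0n; apply/card_gt0P; exists i0.
have eI : 0 < e / #|I|%:R by exact: divr_gt0.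
have /choice[f hf] : forall i, exists nC : nat * set (shspace k), local nC.1 nC.2 /\
    pr m (symd (g @^-1` [set i]) nC.2) <= e / #|I|%:R.
  move=> i; have [_ /(_ _ eI)[n [C [lC AC]]]] := measurable_approximable (fun _ => m) (mg i).
  by exists (n, C); split=> //; exact: (AC true).
pose N := \max_i (f i).1.
pose h x := odflt i0 [pick i | `[< (f i).2 x >]].
have lh x y : agree N x y -> h x = h y.
  move=> xy; rewrite /h; congr odflt; apply: eq_pick => i.
  have lC : local N (f i).2 by apply: local_le (proj1 (hf i)); exact: leq_bigmax.
  by apply/asboolP/asboolP; apply: lC => //; exact: agree_sym.
have mh := fmeas_local lh.
exists N, h; split=> //.
have mS i : measurable (symd (g @^-1` [set i]) (f i).2).
  by apply: measurable_symd => //; apply: local_measurable (proj1 (hf i)).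
have -> : e = \sum_(i : I) e / #|I|%:R.
  by rewrite sumr_const -[_ *+ _]mulr_natr divfK// gt_eqF.
apply: (@le_trans _ _ (\sum_i pr m (symd (g @^-1` [set i]) (f i).2))); last first.
  by apply: ler_sum => i _; exact: (proj2 (hf i)).
apply: le_trans (le_pr_bigU m _ mS); apply: le_pr.
- exact: (fmeas_preimage [set ij | ij.1 != ij.2] (fmeas_pair mg mh)).
- exact: bigsetU_measurable.
move=> x; apply: contraPP; rewrite -bigcup_seq => /= nS; apply/negP; rewrite negbK.
have e1 i : `[< (f i).2 x >] = (i == g x).
  apply/asboolP/eqP => [Cx|gi].
    by apply: contrapT => gi; apply: nS; exists i; rewrite /= ?mem_index_enum//; right; split=> // /esym.
  by apply: contrapT => Cx; apply: nS; exists i; rewrite /= ?mem_index_enum//; left.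
rewrite /h; case: pickP => [i|/(_ (g x))]; rewrite e1 ?eqxx//.
by rewrite eq_sym.
Qed.

Lemma shannon_itin_local_le I (h : shspace k -> I) N n :
  (forall x y, agree N x y -> h x = h y) ->
  shannon m (itin (shift k) h n) <= shannon m (@word k (n + N)).
Proof.
move=> lh; have li x y : agree (n + N) x y -> itin (shift k) h n x = itin (shift k) h n y.
  move=> xy; apply/ffunP => i; rewrite !ffunE; apply: lh => j jN.
  by rewrite !iter_sshift xy// -addnS leq_add// ltnW.
rewrite (local_factor li); apply: shannon_comp; exact: fmeas_word.
Qed.

Lemma shannon_word_subadd n p :
  shannon m (@word k (n + p)) <= shannon m (@word k n) + shannon m (@word k p).
Proof.
rewrite !word_itin; apply: shannon_itin_subadd => //.
- exact: measurable_sshift.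
- exact: fmeas_coord0.
Qed.

(** Up to a small error [g] is a local map [h]. The itineraries of [h] are read off words with [N]
    extra symbols, negligible per unit of time, and the perturbation bound returns from [h] to
    [g]. *)
Lemma sinai I (g : shspace k -> I) (L Lg : R) : fmeas g ->
  (n%:R^-1 * shannon m (@word k n) @[n --> \oo] --> L) ->
  (forall n, (0 < n)%N -> Lg * n%:R <= shannon m (itin (shift k) g n)) -> Lg <= L.
Proof.
move=> mg cL hLg; apply/ler_addgt0Pr => e e0.
(* [q] is chosen so that [- ln (1 - q) = e / 3]. The approximation error [e / 3 / B] then makes the
   other perturbation term at most [e / 3]; the summand [1] keeps [B] positive. *)
pose q := 1 - expR (- (e / 3)); have e3 : 0 < e / 3 by exact: divr_gt0.
have q01 : 0 < q < 1 by rewrite subr_gt0 gtrBl expR_gt0 expR_lt1 oppr_lt0 e3.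
pose B := `|ln (q / #|I|%:R)| + 1.
have B0 : 0 < B by rewrite ltr_wpDl.
have [N [h [lh gh]]] := local_approximation mg (divr_gt0 e3 B0).
have mh := fmeas_local lh.
have key n : (0 < n)%N -> Lg <= n%:R^-1 * shannon m (@word k n) +
    n%:R^-1 * shannon m (@word k N) + (e / 3 + e / 3).
  move=> n0; have nR : (0 : R) < n%:R by rewrite ltr0n.
  rewrite -(ler_pM2r nR); apply: (le_trans (hLg n n0)).
  apply: (le_trans (shannon_itin_perturb (@measurable_sshift k) mI n mg mh q01)).
  have h1 := le_trans (shannon_itin_local_le n lh) (shannon_word_subadd n N).
  have -> : ln (1 - q) = - (e / 3) by rewrite /q opprB addrC subrK expRK.
  have h2 : - (pr m [set x | g x != h x] * ln (q / #|I|%:R)) <= e / 3.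
    rewrite (le_trans (ler_norm _))// normrN normrM ger0_norm ?pr_ge0//.
    rewrite (@le_trans _ _ (e / 3 / B * B))//; last by rewrite divfK// gt_eqF.
    by apply: ler_pM => //; [exact: pr_ge0|rewrite lerDl].
  have E (a : R) : n%:R^-1 * a * n%:R = a by rewrite mulrAC mulVf ?mul1r// gt_eqF.
  have := ler_wpM2l (ltW nR) h2; rewrite opprK !mulrDl !E; move: h1.
  by rewrite mulrDr [_ / _ * n%:R]mulrC; lra.
rewrite -(subrK (e / 3 + e / 3) Lg).
have -> : L + e = (L + e / 3) + (e / 3 + e / 3) by lra.
rewrite lerD2r.
have /cvgrPdist_le/(_ _ (divr_gt0 e3 (ltr0n R 2))) c1 := cL.
have c2 : \forall n \near \oo, (e / 3 / 2)^-1 * shannon m (@word k N) <= n%:R.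
  exact: nbhs_infty_ger.
have c3 : \forall n \near \oo, (0 < n)%N by exists 1%N.
have [n [h3 [h4 n0]]] := filter_ex (filterI c1 (filterI c2 c3)).
have nR : (0 : R) < n%:R by rewrite ltr0n.
have := key n n0; have := ler_norm (- (L - n%:R^-1 * shannon m (@word k n))).
rewrite normrN => h5.
have : n%:R^-1 * shannon m (@word k N) <= e / 3 / 2.
  by rewrite ler_pdivrMl// -ler_pdivrMr ?divr_gt0// mulrC.
move: h3 h5; lra.
Qed.

Lemma entropy_word : exists L : R,
  [/\ n%:R^-1 * shannon m (@word k n) @[n --> \oo] --> L,
      forall n, (0 < n)%N -> L * n%:R <= shannon m (@word k n) &
      entropy m = L%:E].
Proof.
have [L [cL hL]] := shannon_itin_cvg (@measurable_sshift k) mI (@fmeas_coord0 k).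
have {}cL : n%:R^-1 * shannon m (@word k n) @[n --> \oo] --> L.
  by under eq_fun do rewrite word_itin.
exists L; split=> [//|n n0|]; first by rewrite word_itin; exact: hL.
have part r (xi : 'I_r -> set (shspace k)) (g : shspace k -> 'I_r) Lg :
    (forall i x, xi i x <-> g x = i) ->
    (n%:R^-1 * shannon m (itin (shift k) g n) @[n --> \oo] --> Lg) ->
    entropy_part m xi = Lg%:E.
  move=> xig cLg; apply/cvg_lim => //.
  have -> : (fun n => (n%:R^-1 * joinH m xi n)%:E) =
      (fun n => (n%:R^-1 * shannon m (itin (shift k) g n))%:E).
    apply/funext => n; congr (_ * _)%:E; apply: eq_bigr => t _.
    congr (entr (fine (m _))); apply/seteqP; split => [x h|x /= <- i].
      by apply/ffunP => i; rewrite ffunE; apply/xig; exact: h.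
    by rewrite ffunE; exact/xig.
  exact: cvg_comp cLg _.
apply/eqP; rewrite eq_le; apply/andP; split; last first.
  apply: ereal_sup_ubound; exists k.+1, (fun a => [set x | x 0%N = a]); split.
    split; [|split] => [i|i j ij|x].
    - exact: fmeas_coord0.
    - by apply/seteqP; split => // x [/= -> ji]; rewrite ji eqxx in ij.
    - by exists (x 0%N).
  apply/esym/(part _ _ (fun x => x 0%N)) => //.
  by under eq_fun do rewrite -word_itin.
apply: ge_ereal_sup => _ [r [xi [[mxi [xiI xiU]] ->]]].
have /choice[g hg] := xiU.
have xig i x : xi i x <-> g x = i.
  split=> [xix|<-]; last exact: hg.
  apply: contrapT => /eqP gi; have : (xi (g x) `&` xi i) x by split; [exact: hg|].
  by rewrite xiI.
have mg : fmeas g.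
  by move=> i; rewrite (_ : g @^-1` _ = xi i)//; apply/seteqP; split => x /xig.
have [Lg [cLg hLg]] := shannon_itin_cvg (@measurable_sshift k) mI mg.
by rewrite (part _ _ _ _ xig cLg) lee_fin (sinai mg cL hLg).
Qed.

End entropy_formula.

(** * Relative entropy and absolute continuity *)

Section absolute_continuity.
Context (R : realType) (k : nat) (m nu : probability (shspace k) R).

(** The Kullback-Leibler divergence of the word laws. Because [ln 0 = 0], it has this meaning only
    when every word charged by [m] is charged by [nu]. *)
Definition relent n : R := expect m (@word k n)
  (fun w => ln (law m (@word k n) w) - ln (law nu (@word k n) w)).

(* Gibbs' inequality against the law of [nu] tilted by [expR t] on [A]. *)
Lemma relent_tilt n (A : set (shspace k)) (t : R) : local n A ->
  (forall w, law nu (@word k n) w = 0 -> law m (@word k n) w = 0) ->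
  t * pr m A <= relent n + expR t * pr nu A.
Proof.
move=> lA ac; pose S w := `[< A (@pad k n w) >].
have AS : A = [set x | S (word n x)].
  apply/seteqP; split => x /=.
    by move=> Ax; apply/asboolP; apply: lA Ax; apply: agree_sym; exact: agree_pad.
  by move/asboolP; apply: lA; exact: agree_pad.
have mw := @fmeas_word k n.
rewrite AS !(pr_preimage _ S mw).
pose q w := law nu (@word k n) w * (if S w then expR t else 1).
have f0 w : 0 < (if S w then expR t else 1) by case: (S w); rewrite ?expR_gt0.
have q0 w : 0 <= q w by rewrite mulr_ge0 ?law_ge0// ltW.
have qp w : q w = 0 -> law m (@word k n) w = 0.
  by move/eqP; rewrite mulf_eq0 (gt_eqF (f0 w)) orbF => /eqP/ac.
have := gibbs_ineq (law_ge0 m (@word k n)) q0 qp; rewrite law_sum1//.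
have -> : \sum_w law m (@word k n) w * ln (q w) =
    \sum_w law m (@word k n) w * ln (law nu (@word k n) w) + t * \sum_(w | S w) law m (@word k n) w.
  rewrite mulr_sumr [X in _ + X]big_mkcond -big_split/=; apply: eq_bigr => w _.
  have [nu0|nu0] := eqVneq (law nu (@word k n) w) 0.
    by rewrite (ac _ nu0) !mul0r mulr0 add0r; case: ifP.
  have nup : 0 < law nu (@word k n) w by rewrite lt_neqAle eq_sym nu0 law_ge0.
  rewrite /q lnM ?posrE// mulrDr; congr (_ + _).
  by case: ifP => _; rewrite ?expRK ?ln1 ?mulr0// mulrC.
(* Tilting adds at most [expR t * pr nu A] to the mass; the [1] cancels the mass of the law of
   [m]. *)
have : \sum_w q w <= 1 + expR t * \sum_(w | S w) law nu (@word k n) w.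
  rewrite -[X in X + _](law_sum1 nu mw) mulr_sumr [X in _ + X]big_mkcond -big_split/=.
  apply: ler_sum => w _; rewrite /q; case: ifP => _; last by rewrite mulr1 addr0.
  by rewrite mulrC lerDr law_ge0.
have -> : relent n = \sum_w law m (@word k n) w * ln (law m (@word k n) w) -
    \sum_w law m (@word k n) w * ln (law nu (@word k n) w).
  by rewrite -sumrB; apply: eq_bigr => w _; rewrite mulrBr.
lra.
Qed.

Lemma symd_pr (P : probability (shspace k) R) A C : measurable A -> measurable C ->
  pr P A <= pr P C + pr P (symd A C).
Proof.
move=> mA mC; have mS := measurable_symd mA mC.
apply: le_trans (le_prU P mC mS); apply: le_pr => //; first exact: measurableU.
by move=> x Ax; have [Cx|nC] := pselect (C x); [left|right; left].
Qed.

(** On approximants of a [nu]-null set the tilted inequality leaves [t * pr m A <= C] for every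
    [t > 0], and [t] is arbitrarily large. *)
Lemma relent_abs_cont (C : R) :
  (forall n, (0 < n)%N -> forall w, law nu (@word k n) w = 0 -> law m (@word k n) w = 0) ->
  (forall n, (0 < n)%N -> relent n <= C) ->
  forall A : set (shspace k), measurable A -> pr nu A = 0 -> pr m A = 0.
Proof.
move=> ac hC A mA nuA.
have key (t : R) : 0 < t -> t * pr m A <= C.
  move=> t0; apply/ler_addgt0Pr => e e0.
  (* With this [d] the two approximation errors [t * d] and [expR t * d] sum to [e]. *)
  pose d := e / (t + expR t); have te0 : 0 < t + expR t by rewrite addr_gt0 ?expR_gt0.
  have d0 : 0 < d by exact: divr_gt0.
  have [_ /(_ _ d0)[n [B [lB AB]]]] :=
    measurable_approximable (fun b : bool => if b then m else nu) mA.
  have mB := local_measurable lB.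
  have lB1 := local_le (leqnSn n) lB.
  have h1 := relent_tilt t lB1 (ac n.+1 isT); have h2 := hC n.+1 isT.
  have h3 := symd_pr m mA mB; have h4 := AB true; have h5 := AB false.
  have h6 := symd_pr nu mB mA; rewrite nuA add0r /symd setUC in h6.
  have h7 : pr nu B <= d by exact: le_trans h6 h5.
  have h8 : expR t * pr nu B <= expR t * d by rewrite ler_pM2l ?expR_gt0.
  have h9 : t * pr m A <= t * (pr m B + d).
    by rewrite ler_pM2l//; apply: le_trans h3 _; rewrite lerD2l.
  have h10 : e = t * d + expR t * d by rewrite -mulrDl /d mulrC divfK// gt_eqF.
  by rewrite h10; lra.
apply/eqP; rewrite eq_le pr_ge0 andbT leNgt; apply/negP => p0.
have t0 : 0 < (`|C| + 1) / pr m A by rewrite divr_gt0// ltr_wpDl.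
have := key _ t0; rewrite divfK ?gt_eqF//; have := ler_norm C; lra.
Qed.

Hypothesis mI : forall A : set (shspace k), measurable A ->
  m (@sshift k @^-1` A) = m A.
Hypothesis nuI : forall A : set (shspace k), measurable A ->
  nu (@sshift k @^-1` A) = nu A.

Lemma hahn_maximizer : exists P : set (shspace k), measurable P /\
  forall A, measurable A -> pr m A - pr nu A <= pr m P - pr nu P.
Proof.
pose rho := cadd (charge_of_finite_measure m) (copp (charge_of_finite_measure nu)).
have rhoE A : measurable A -> rho A = (pr m A - pr nu A)%:E.
  by move=> mA; rewrite /rho /cadd/= /copp/= /charge_of_finite_measure EFinB !prE.
have [P [N [[mP posP] [mN negN] PNT PN0]]] := Hahn_decomposition rho.
exists P; split=> // A mA.
have sub B C : measurable B -> measurable C ->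
    pr m B - pr nu B = (pr m (B `&` C) - pr nu (B `&` C)) + (pr m (B `\` C) - pr nu (B `\` C)).
  move=> mB mC; have mI' := measurableI B C mB mC; have mD' := measurableD mB mC.
  have dj : (B `&` C) `&` (B `\` C) = set0 by rewrite setDE setIACA setICr setI0.
  by rewrite -{1 2}(setUIDK B C) !prU//; lra.
have mAP := measurableI A P mA mP.
have h1 : pr m (A `\` P) - pr nu (A `\` P) <= 0.
  have mAD := measurableD mA mP.
  rewrite -lee_fin -rhoE//; apply: negN => // x [Ax nPx].
  by have : [set: shspace k] x by []; rewrite -PNT => -[].
have h2 : 0 <= pr m (P `\` A) - pr nu (P `\` A).
  have mPD := measurableD mP mA.
  by rewrite -lee_fin -rhoE//; apply: posP => // x [].
by rewrite (sub A P mA mP) (sub P A mP mA) [P `&` A]setIC; lra.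
Qed.

End absolute_continuity.

(** * An invariant measure absolutely continuous with respect to an ergodic one *)

Section ergodic_uniqueness.
Context (R : realType) (k : nat).
Implicit Types P m nu : probability (shspace k) R.

Definition shift_invariant P : Prop := forall A : set (shspace k),
  measurable A -> P (@sshift k @^-1` A) = P A.

Lemma measurable_iter_sshift n (A : set (shspace k)) :
  measurable A -> measurable (iter n (shift k) @^-1` A).
Proof.
move=> mA; elim: n => [//|n IH]; rewrite (_ : _ @^-1` A = shift k @^-1` (iter n (shift k) @^-1` A)).
  exact: measurable_sshift.
by apply/seteqP; split => x; rewrite /preimage/= -iterSr.
Qed.

Lemma pr_iter_sshift P n (A : set (shspace k)) : shift_invariant P -> measurable A ->
  pr P (iter n (shift k) @^-1` A) = pr P A.
Proof.
move=> PI mA; elim: n => [//|n <-].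
rewrite (_ : _ @^-1` A = shift k @^-1` (iter n (shift k) @^-1` A)).
  by rewrite /pr PI//; exact: measurable_iter_sshift.
by apply/seteqP; split => x; rewrite /preimage/= -iterSr.
Qed.

(** The iterated preimages of [U] decrease and all have the mass of [U], hence so does their
    intersection. *)
Lemma pr_bigcap_preimage P (U : set (shspace k)) : shift_invariant P -> measurable U ->
  shift k @^-1` U `<=` U ->
  pr P (\bigcap_n (iter n (shift k) @^-1` U)) = pr P U.
Proof.
move=> PI mU UU; pose F n := ~` (iter n (shift k) @^-1` U).
have mT n := measurable_iter_sshift n mU.
have mF n : measurable (F n) by exact: measurableC.
have FS n : F n `<=` F n.+1 by move=> x nU Ux; apply: nU; exact: UU.
have ndF i j : (i <= j)%N -> F i `<=` F j.
  by move=> /subnKC <-; elim: (j - i)%N => [|n IH]; rewrite ?addn0// addnS; exact: subset_trans IH (FS _).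
have mQ : measurable (\bigcap_n (iter n (shift k) @^-1` U)) by exact: bigcap_measurable.
have := pr_bigcup_cvg (P := P) mF ndF; rewrite /F -setC_bigcap prC//.
under eq_fun do rewrite prC// pr_iter_sshift//.
move=> /(cvg_unique _ (cvg_cst _)) => /(_ (@Rhausdorff R)); lra.
Qed.

Lemma prUI P (A B : set (shspace k)) : measurable A -> measurable B ->
  pr P (A `|` B) + pr P (A `&` B) = pr P A + pr P B.
Proof.
move=> mA mB; have mBA := measurableD mB mA; have mI := measurableI B A mB mA.
have -> : A `|` B = A `|` (B `\` A).
  apply/seteqP; split => x [Ax|]; [by left| |by left|by move=> [Bx _]; right].
  by move=> Bx; have [Ax|nA] := pselect (A x); [left|right].
rewrite -{3}(setUIDK B A) !prU// ?[A `&` B]setIC; first by lra.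
  by rewrite setDE setIACA setICr setI0.
by rewrite setDE setICA setICr setI0.
Qed.

(** Maximizers of [m - nu] are stable under preimage by invariance, under union because union and
    intersection together reach [2 M] with neither exceeding [M], and under monotone limits. From a
    Hahn set this yields an invariant maximizer [Q]. Ergodicity makes [Q] null or full for [nu],
    absolute continuity makes it so for [m], and the maximum is [0]; applied to [A] and its
    complement, this gives equality. *)
Lemma ergodic_unique m nu : shift_invariant m -> shift_invariant nu ->
  (forall A : set (shspace k), measurable A -> shift k @^-1` A = A ->
    pr nu A = 0 \/ pr nu A = 1) ->
  (forall A : set (shspace k), measurable A -> pr nu A = 0 -> pr m A = 0) ->
  same_measure m nu.
Proof.
move=> mI nuI erg ac; have [P0 [mP0 maxP]] := hahn_maximizer m nu.
pose r A := pr m A - pr nu A; pose M := r P0.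
pose maximal A := measurable A /\ r A = M.
have maximalU A B : maximal A -> maximal B -> maximal (A `|` B).
  move=> [mA rA] [mB rB]; split; first exact: measurableU.
  have := maxP _ (measurableI A B mA mB); have := maxP _ (measurableU A B mA mB).
  have := prUI m mA mB; have := prUI nu mA mB; move: rA rB; rewrite /M /r; lra.
have maximalT n : maximal (iter n (shift k) @^-1` P0).
  by split; [exact: measurable_iter_sshift|rewrite /r !pr_iter_sshift].
pose B n := \big[setU/set0]_(i < n.+1) (iter i (shift k) @^-1` P0).
have maximalB n : maximal (B n).
  elim: n => [|n IH]; first by rewrite /B big_ord1; exact: (maximalT 0%N).
  by rewrite /B big_ord_recr/=; exact: maximalU IH (maximalT n.+1).
pose U := \bigcup_n B n.
have mB n : measurable (B n) by case: (maximalB n).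
have mU : measurable U by exact: bigcup_measurable.
have UE : U = \bigcup_n (iter n (shift k) @^-1` P0).
  rewrite /U /B; apply/seteqP; split => [x [n _]|x [i _ Px]].
    by rewrite -(bigcup_mkord n.+1 (fun i => iter i (shift k) @^-1` P0)) => -[i _ Px]; exists i.
  by exists i => //; rewrite big_ord_recr/=; right.
have ndB i j : (i <= j)%N -> B i `<=` B j.
  by move=> ij; apply: (subset_bigsetU (F := fun i => iter i (shift k) @^-1` P0)).
have rU : r U = M.
  have h : (fun=> M) @ \oo --> pr m U - pr nu U.
    rewrite (_ : (fun=> M) = (fun n => pr m (B n)) - (fun n => pr nu (B n))).
      exact: cvgB (pr_bigcup_cvg (P := m) mB ndB) (pr_bigcup_cvg (P := nu) mB ndB).
    by apply/funext => n; rewrite -(proj2 (maximalB n)).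
  exact: (cvg_unique (@Rhausdorff R) h (cvg_cst _)).
have UU : shift k @^-1` U `<=` U.
  by rewrite UE => x [n _ Px]; exists n.+1 => //; rewrite /preimage/= -iterS iterSr.
(* [U] is only known to contain its preimage; [Q], the set of points visiting [P0] infinitely often,
   is exactly invariant. *)
pose Q := \bigcap_n (iter n (shift k) @^-1` U).
have mQ : measurable Q by apply: bigcap_measurable => // n _; exact: measurable_iter_sshift.
have QI : shift k @^-1` Q = Q.
  apply/seteqP; split => x Qx n _.
    case: n => [|n]; first by apply: UU; exact: (Qx 0%N).
    by rewrite /preimage/= -iterS iterSr; exact: Qx.
  by rewrite /preimage/= -iterSr; exact: Qx.
have rQ : pr m Q - pr nu Q = M by rewrite !pr_bigcap_preimage.
have M0 : M = 0.
  have [nQ|nQ] := erg Q mQ QI; first by rewrite -rQ nQ (ac Q mQ nQ) subrr.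
  have nQC : pr nu (~` Q) = 0 by rewrite prC// nQ subrr.
  by have := ac _ (measurableC mQ) nQC; rewrite prC// -rQ nQ; lra.
move=> A mA; rewrite -!prE//; congr (_%:E).
have := maxP A mA; have := maxP _ (measurableC mA); rewrite !prC// -/(r P0) -/M M0; lra.
Qed.

End ergodic_uniqueness.

(** * Measures carried by a subshift; integrals of locally constant functions *)

Section locally_constant_integral.
Context (R : realType) (k : nat).
Implicit Types (m : probability (shspace k) R) (Y : set (shsp k)).

Lemma subshift_measurable Y : subshift Y -> measurable (Y : set (shspace k)).
Proof.
move=> [clY _]; pose F n := [set x : shspace k | exists2 y, Y y & agree n y x].
have -> : Y = \bigcap_n F n.
  apply/seteqP; split => [x Yx n _|x Fx]; first by exists x.
  by apply: clY => n; exact: Fx.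
apply: bigcap_measurable => // n _; apply: (@local_measurable k n) => x y xy [z Yz zx].
by exists z => // i ni; rewrite zx// xy.
Qed.

Lemma pr_setI_full m Y (A : set (shspace k)) : subshift Y -> m Y = 1%E ->
  measurable A -> pr m (A `&` Y) = pr m A.
Proof.
move=> /subshift_measurable mY mY1 mA; have mAY := measurableI A _ mA mY.
apply/eqP; rewrite eq_le le_pr//= -subr_le0 -prD//.
apply: (@le_trans _ _ (pr m (~` (Y : set (shspace k))))).
  apply: le_pr; [exact: measurableD|exact: measurableC|].
  by move=> x [Ax nAY] Yx; apply: nAY.
by rewrite prC// [pr m _]/pr mY1 subrr.
Qed.

(** A word with no point of [Y] has a cylinder disjoint from [Y], hence null. In this way estimates
    known on [Y] reach every charged word. *)
Lemma law_word_gt0 m Y n w : subshift Y -> m Y = 1%E ->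
  0 < law m (@word k n) w -> exists2 y, Y y & word n y = w.
Proof.
move=> sY mY1; apply: contraPP => nw.
rewrite /law -(pr_setI_full sY mY1); last exact: fmeas_word.
rewrite (_ : _ `&` _ = set0) /pr ?measure0 ?ltxx//.
by apply/seteqP; split => // x [xw Yx]; apply: nw; exists x.
Qed.

Lemma pr_cyl m n (y : shspace k) : pr m (cyl n y) = law m (@word k n) (word n y).
Proof. by rewrite cylE. Qed.

Lemma integral_word m Y n (F : shsp k -> R) : subshift Y -> m Y = 1%E ->
  (forall x y : shspace k, agree n x y -> F x = F y) ->
  (\int[m]_(x in (Y : set (shspace k))) (F x)%:E)%E =
    (expect m (@word k n) (fun w => F (pad w)))%:E.
Proof.
move=> sY mY1 lF; have mY := subshift_measurable sY.
have mw w : measurable (@word k n @^-1` [set w]) by exact: fmeas_word.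
have -> : (\int[m]_(x in (Y : set (shspace k))) (F x)%:E)%E =
  (\int[m]_(x in (Y : set (shspace k))) \sum_(w : {ffun 'I_n -> 'I_k.+1})
     ((F (pad w))%:E * (\1_(@word k n @^-1` [set w]) x)%:E))%E.
  apply: eq_integral => x _; rewrite (bigD1 (word n x))//= big1 ?adde0.
    by rewrite indicE mem_set// mule1; congr (_%:E); apply: lF; apply: agree_sym; exact: agree_pad.
  move=> w wx; rewrite indicE memNset ?mule0//= => xw.
  by rewrite xw eqxx in wx.
have iI w : m.-integrable (Y : set (shspace k)) (fun x => (\1_(@word k n @^-1` [set w]) x)%:E).
  by apply: (@integrableS _ _ _ m setT) => //; exact: integrable_indic.
rewrite integral_sum//; last by move=> w; apply: integrableZl.
rewrite /expect -sumEFin; apply: eq_bigr => w _.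
rewrite integralZl// integral_indic//.
rewrite [law _ _ _ * _]mulrC EFinM /law -(pr_setI_full sY mY1)// prE//.
exact: measurableI.
Qed.

End locally_constant_integral.

(** * Variational principle and uniqueness for a potential comparable to [nu] *)

Section comparable_potential.
Context (R : realType) (k : nat) (Y : set (shsp k)) (G : potseq R k).
Variables (nu : probability (shspace k) R) (K c : R).
Hypothesis sY : subshift Y.
Hypothesis nuI : invariant_on Y nu.
Hypothesis K0 : 0 < K.
Hypothesis c0 : 0 < c.
Hypothesis nuG : forall n, (0 < n)%N -> forall y, Y y ->
  K^-1 * G n y <= pr nu (cyl n y) <= K * G n y.
Hypothesis nu_ge : forall n, (0 < n)%N -> forall y, Y y -> c ^+ n <= pr nu (cyl n y).
Hypothesis nu_submul : forall n p, (0 < n)%N -> (0 < p)%N -> forall y : shsp k,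
  pr nu (cyl (n + p) y) <= K * (pr nu (cyl n y) * pr nu (cyl p (iter n sshift y))).
Hypothesis Gloc : forall n (x y : shspace k), agree n x y -> G n x = G n y.
Hypothesis erg : forall A : set (shspace k), measurable A -> shift k @^-1` A = A ->
  pr nu A = 0 \/ pr nu A = 1.
Implicit Types m : probability (shspace k) R.

Definition log_law m n : R :=
  expect m (@word k n) (fun w => ln (law nu (@word k n) w)).

Lemma pr_nu_cyl_gt0 n y : (0 < n)%N -> Y y -> 0 < pr nu (cyl n y).
Proof. by move=> n0 Yy; apply: lt_le_trans (nu_ge n0 Yy); exact: exprn_gt0. Qed.

Lemma comparable_gt0 n y : (0 < n)%N -> Y y -> 0 < G n y.
Proof.
move=> n0 Yy; have /andP[_ h] := nuG n0 Yy.
by rewrite -(pmulr_rgt0 _ K0); apply: lt_le_trans h; exact: pr_nu_cyl_gt0.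
Qed.

Lemma law_word_supported m n w : (0 < n)%N -> m Y = 1%E -> 0 < law m (@word k n) w ->
  [/\ 0 < law nu (@word k n) w, c ^+ n <= law nu (@word k n) w,
      0 < G n (pad w) & `|ln (G n (pad w)) - ln (law nu (@word k n) w)| <= ln K].
Proof.
move=> n0 mY1 pw; have [y Yy <-] := law_word_gt0 sY mY1 pw.
have -> : G n (pad (word n y)) = G n y by apply: Gloc; exact: agree_pad.
rewrite -pr_cyl; have G0 := comparable_gt0 n0 Yy; have p0 := pr_nu_cyl_gt0 n0 Yy.
split=> //; first exact: nu_ge.
have /andP[h1 h2] := nuG n0 Yy.
have {}h1 : G n y <= K * pr nu (cyl n y) by rewrite -ler_pdivrMl.
rewrite ler_norml lerBlDr lerBrDl -lnM ?posrE//.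
have -> : ln (K * pr nu (cyl n y)) = ln K + ln (pr nu (cyl n y)) by rewrite lnM ?posrE.
by rewrite lerBlDr -!lnM ?posrE// !ler_ln ?posrE ?mulr_gt0// [G n y * K]mulrC h2 h1.
Qed.

Lemma log_law_subadd m n p : invariant_on Y m -> (0 < n)%N -> (0 < p)%N ->
  log_law m (n + p) <= log_law m n + log_law m p + ln K.
Proof.
move=> [mY1 mI] n0 p0; have mw := @fmeas_word k (n + p).
pose u (w : {ffun 'I_(n + p) -> 'I_k.+1}) := word n (pad w).
pose v (w : {ffun 'I_(n + p) -> 'I_k.+1}) := word p (iter n (shift k) (pad w)).
have wu : @word k n = u \o @word k (n + p).
  apply/funext => x; apply/esym/wordP => i ni; apply: agree_pad.
  exact: (leq_trans ni (leq_addr _ _)).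
have wv : @word k p \o iter n (shift k) = v \o @word k (n + p).
  apply/funext => x; apply/esym/wordP => i ni; rewrite !iter_sshift; apply: agree_pad.
  by rewrite ltn_add2l.
have mwp := @fmeas_word k p.
rewrite /log_law -(expect_iter (@measurable_sshift k) mI n _ mwp) wv {1}wu.
rewrite !expect_comp// -expectD -(expect_cst m (ln K) mw) -expectD.
apply: le_expect => w pw /=.
(* A word charged by [m] is charged by [nu]; submultiplicativity then makes both of its pieces
   charged, so that the logarithms split. *)
have [nu0 _ _ _] := law_word_supported (ltn_addr p n0) mY1 pw.
have := nu_submul n0 p0 (pad w); rewrite !pr_cyl word_pad -/(u w) -/(v w) => h.
have : 0 < K * (law nu (@word k n) (u w) * law nu (@word k p) (v w)) by exact: lt_le_trans h.
rewrite pmulr_rgt0// => uv0.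
have u0 : 0 < law nu (@word k n) (u w).
  rewrite lt_neqAle law_ge0 andbT eq_sym; apply: contraTN uv0 => /eqP ->.
  by rewrite mul0r ltxx.
have v0 : 0 < law nu (@word k p) (v w) by rewrite pmulr_rgt0 in uv0.
by rewrite -!lnM ?posrE ?mulr_gt0// ler_ln ?posrE ?mulr_gt0// mulrC.
Qed.

Lemma relentE m n : relent m nu n = - shannon m (@word k n) - log_law m n.
Proof.
rewrite shannonE opprK /log_law /relent /expect -sumrB.
by apply: eq_bigr => w _; rewrite mulrBr.
Qed.

Lemma law_word_null m n w : (0 < n)%N -> m Y = 1%E ->
  law nu (@word k n) w = 0 -> law m (@word k n) w = 0.
Proof.
move=> n0 mY1 nu0; apply/eqP; rewrite eq_le law_ge0 andbT leNgt; apply/negP => pw.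
by have [] := law_word_supported n0 mY1 pw; rewrite nu0 ltxx.
Qed.

Lemma relent_ge0 m n : (0 < n)%N -> m Y = 1%E -> 0 <= relent m nu n.
Proof.
move=> n0 mY1; rewrite relentE subr_ge0 lerNr; apply: shannon_le.
- exact: fmeas_word.
- by move=> w; exact: law_ge0.
- by move=> w; exact: law_word_null.
- by rewrite law_sum1//; exact: fmeas_word.
Qed.

Lemma cvg_divn (a : R) : n%:R^-1 * a @[n --> \oo] --> (0 : R).
Proof.
rewrite -[X in _ --> X](mul0r a); apply: cvgMl.
apply/gtr0_cvgV0; first by exists 1%N => // n /= n0; rewrite ltr0n.
exact/cvgryPge/nbhs_infty_ger.
Qed.

(** On charged words [ln G] and the logarithm of the [nu]-mass differ by at most [ln K], which
    disappears after division by [n]. *)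
Lemma pot_integral_cvg m (L : R) : invariant_on Y m ->
  n%:R^-1 * (log_law m n + ln K) @[n --> \oo] --> L ->
  pot_integral Y G m = L%:E.
Proof.
move=> [mY1 mI] cL; apply/cvg_lim => //.
pose pG n := expect m (@word k n) (fun w => ln (G n (pad w))).
have -> : (fun n => (n%:R^-1)%:E * \int[m]_(x in (Y : set (shspace k))) (ln (G n x))%:E)%E =
    (fun n => (n%:R^-1 * pG n)%:E).
  apply/funext => n; rewrite EFinM; congr (_ * _)%E; apply: integral_word => //.
  by move=> x y xy; rewrite (Gloc xy).
have near n : (0 < n)%N -> `|pG n - log_law m n| <= ln K.
  move=> n0; have mw := @fmeas_word k n.
  have h w : 0 < law m (@word k n) w ->
      - ln K <= ln (G n (pad w)) - ln (law nu (@word k n) w) <= ln K.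
    by move=> pw; have [_ _ _] := law_word_supported n0 mY1 pw; rewrite ler_norml.
  rewrite ler_norml; apply/andP; split.
    rewrite lerBrDl -[X in _ + X](expect_cst m _ mw) -expectD; apply: le_expect => w /h /andP[].
    lra.
  rewrite lerBlDl -[X in _ + X](expect_cst m _ mw) -expectD; apply: le_expect => w /h /andP[].
  lra.
suff cG : n%:R^-1 * pG n @[n --> \oo] --> L by exact: cvg_comp cG _.
(* Subtracting [2 ln K] turns the given sequence into the lower bound [log_law m n - ln K] of the
   squeeze. *)
have c1 : n%:R^-1 * (log_law m n + ln K) + n%:R^-1 * (- (ln K *+ 2)) @[n --> \oo] --> L.
  by rewrite -[X in _ --> X]addr0; apply: cvgD cL (cvg_divn _).
apply: squeeze_cvgr c1 cL; exists 1%N => // n /= n0.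
have := near n n0; rewrite ler_norml => /andP[h1 h2].
have nR : 0 <= n%:R^-1 :> R by [].
by rewrite -mulrDr !ler_wpM2l//; lra.
Qed.

(** Fekete's lemma applies separately to word entropy and to [log_law + ln K]. The limits are the
    two terms of the free energy, and their sum inherits the bound at every length. *)
Lemma free_energy m : invariant_on Y m -> exists L : R,
  [/\ (entropy m + pot_integral Y G m = L%:E)%E,
      forall n, (0 < n)%N -> L * n%:R <= ln K - relent m nu n &
      n%:R^-1 * (ln K - relent m nu n) @[n --> \oo] --> L].
Proof.
move=> mY; have [mY1 mI] := mY.
have [L1 [c1 h1 e1]] := entropy_word mI.
have [L2 [c2 h2]] : exists L2 : R, (n%:R^-1 * (log_law m n + ln K) @[n --> \oo] --> L2) /\
    forall n, (0 < n)%N -> L2 * n%:R <= log_law m n + ln K.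
  (* The slope [ln c] comes from the exponential lower bound; [- |ln K|] per symbol absorbs the
     single constant [ln K]. *)
  apply: (@fekete _ _ (ln c - `|ln K|)) => [n p n0 p0|n n0].
    by have := log_law_subadd mY n0 p0; lra.
  have mw := @fmeas_word k n.
  apply: (@le_trans _ _ (ln c * n%:R - `|ln K|)).
    rewrite mulrBl lerD2l lerN2 ler_peMr// ler1n//.
  apply: lerD; last by rewrite lerNl -normrN ler_norm.
  rewrite -(expect_cst m (ln c * n%:R) mw); apply: le_expect => w pw.
  have [p0 pc _ _] := law_word_supported n0 mY1 pw.
  by rewrite mulr_natr -lnXn// ler_ln ?posrE ?exprn_gt0.
exists (L1 + L2); split.
- by rewrite e1 (pot_integral_cvg mY c2).
- by move=> n n0; rewrite relentE mulrDl; have := h1 n n0; have := h2 n n0; lra.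
- have -> : (fun n => n%:R^-1 * (ln K - relent m nu n)) =
     (fun n => n%:R^-1 * shannon m (@word k n) + n%:R^-1 * (log_law m n + ln K)).
    by apply/funext => n; rewrite relentE -mulrDr; congr (_ * _); lra.
  exact: cvgD.
Qed.

Lemma free_energy_le0 m : invariant_on Y m -> (entropy m + pot_integral Y G m <= 0)%E.
Proof.
move=> mY; have [mY1 _] := mY; have [L [-> hL cL]] := free_energy mY.
rewrite lee_fin; apply: ler_cvg_to cL (cvg_divn (ln K)) _.
exists 1%N => // n /= n0; apply: ler_wpM2l => //.
by rewrite gerBl relent_ge0.
Qed.

Lemma free_energy_nu : (entropy nu + pot_integral Y G nu = 0)%E.
Proof.
have [L [-> _ cL]] := free_energy nuI; congr (_%:E).
have E n : relent nu nu n = 0.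
  by rewrite /relent /expect big1// => w _; rewrite subrr mulr0.
have {}cL : n%:R^-1 * ln K @[n --> \oo] --> L.
  have -> : (fun n => n%:R^-1 * ln K) = (fun n => n%:R^-1 * (ln K - relent nu nu n)).
    by apply/funext => n; rewrite E subr0.
  exact: cL.
exact: (cvg_unique (@Rhausdorff R) cL (cvg_divn _)).
Qed.

Lemma relent_bounded_same_measure m (C : R) : invariant_on Y m ->
  (forall n, (0 < n)%N -> relent m nu n <= C) -> same_measure m nu.
Proof.
move=> [mY1 mI] hC; have [_ nI] := nuI; apply: ergodic_unique => //.
apply: (@relent_abs_cont _ _ _ _ C) => // n n0 w.
exact: law_word_null.
Qed.

Lemma comparable_equilibrium : equilibrium Y G nu.
Proof. by split=> // m mY; rewrite free_energy_nu; exact: free_energy_le0. Qed.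

(** Comparison with [nu] gives [0 <= L], and the bound at every length then reads
    [relent m nu n <= ln K]. *)
Lemma equilibrium_unique m : equilibrium Y G m -> same_measure m nu.
Proof.
move=> [mY /(_ _ nuI)]; rewrite free_energy_nu.
have [L [-> hL _]] := free_energy mY; rewrite lee_fin => L0.
apply: (relent_bounded_same_measure mY (C := ln K)) => n n0.
by have := hL n n0; have : 0 <= L * n%:R by [rewrite mulr_ge0]; lra.
Qed.

Lemma comparable_gibbs : pressure Y G = 0%E -> gibbs Y G nu.
Proof.
move=> P0; exists (K + K) => y Yy n n0; have G0 := comparable_gt0 n0 Yy.
have /andP[h1 h2] := nuG n0 Yy.
rewrite P0 /= mulr0 oppr0 expR0 mul1r; apply/andP; split.
  rewrite ltr_pdivlMr//; apply: lt_le_trans h1; rewrite ltr_pM2r//.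
  by rewrite ltf_pV2 ?posrE ?addr_gt0// ltrDl.
rewrite ltr_pdivrMr//; apply: (le_lt_trans h2); rewrite ltr_pM2r// ltrDl//.
Qed.

(** Both measures are comparable to [G], hence [m] is at most [C * K] times [nu] on cylinders, which
    bounds the relative entropy by [ln (C * K)]. *)
Lemma gibbs_unique m : pressure Y G = 0%E -> invariant_on Y m -> gibbs Y G m ->
  same_measure m nu.
Proof.
move=> P0 mY [C hC]; have [mY1 _] := mY.
have hC' n y : (0 < n)%N -> Y y -> 0 < C /\ pr m (cyl n y) <= C * K * pr nu (cyl n y).
  move=> n0 Yy; have G0 := comparable_gt0 n0 Yy.
  have /andP[_] := hC y Yy n n0; rewrite P0 /= mulr0 oppr0 expR0 mul1r => h.
  have C0 : 0 < C by apply: le_lt_trans h; rewrite divr_ge0// ?pr_ge0// ltW.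
  split=> //; rewrite ltr_pdivrMr// in h; apply: (le_trans (ltW h)).
  rewrite -mulrA ler_pM2l// -ler_pdivrMl//.
  by have /andP[] := nuG n0 Yy.
apply: (relent_bounded_same_measure mY (C := ln (C * K))) => n n0.
have mw := @fmeas_word k n.
rewrite -(expect_cst m (ln (C * K)) mw); apply: le_expect => w pw.
have [nu0 _ _ _] := law_word_supported n0 mY1 pw.
have [y Yy yw] := law_word_gt0 sY mY1 pw.
have [C0] := hC' n y n0 Yy; rewrite !pr_cyl yw => h.
by rewrite lerBlDr -lnM ?posrE ?mulr_gt0// ler_ln ?posrE ?mulr_gt0.
Qed.

End comparable_potential.

(** * Vanishing of the pressure of a comparable potential *)

Section zero_pressure.
Context (R : realType) (k : nat) (Y : set (shsp k)) (G : potseq R k).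
Variables (nu : probability (shspace k) R) (K : R).
Hypothesis sY : subshift Y.
Hypothesis nuY : nu Y = 1%E.
Hypothesis K0 : 0 < K.
Hypothesis nuG : forall n, (0 < n)%N -> forall y, Y y ->
  K^-1 * G n y <= pr nu (cyl n y) <= K * G n y.

Lemma sdist_head (x y : shsp k) : x 0%N != y 0%N -> sdist x y = 1 :> R.
Proof.
move=> xy; rewrite /sdist; case: pselect => [h|[]]; last by exists 0%N.
by case: ex_minnP => -[//|j] _ /(_ 0%N xy).
Qed.

Lemma sdist_gt (x y : shsp k) N (e : R) : 0 < e -> 2^-1 ^+ N <= e -> e < sdist x y ->
  exists2 j, (j < N)%N & x j != y j.
Proof.
move=> e0 Ne; rewrite /sdist; case: pselect => [h|_]; last by rewrite ltNge ltW.
case: ex_minnP => j xyj _ ej; exists j => //.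
rewrite ltnNge; apply/negP => Nj; move: ej; apply/negP; rewrite -leNgt.
by apply: le_trans Ne; rewrite ler_wiXn2l ?invr_ge0// invf_le1// ler1n.
Qed.

Lemma sum_inj_le (T : choiceType) (I : finType) (E : set T) (h : T -> I) (F : I -> R) :
  finite_set E -> set_inj E h -> (forall i, 0 <= F i) ->
  \sum_(x \in E) F (h x) <= \sum_i F i.
Proof.
move=> finE hinj F0; rewrite -(fsbig_image E h F hinj).
pose P i := `[< (h @` E) i >].
have -> : h @` E = [set` P] by apply/seteqP; split => i /=; [move/asboolP|move/asboolP].
rewrite -(bigfs _ (r := index_enum I)) ?index_enum_uniq//; last first.
  by move=> i _ /negP[]; rewrite mem_index_enum.
by rewrite [leRHS](bigID P)/= lerDl sumr_ge0.
Qed.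

(** Points separated at scale [e] over time [n] already differ within the first [n + N] symbols. So
    a word of length [n] is shared by at most as many of them as there are words of length [N], each
    contributing at most [K] times the [nu]-mass of that word. *)
Lemma sepsum_le n N (e : R) : (0 < n)%N -> 0 < e -> 2^-1 ^+ N <= e ->
  (sepsum Y G n e <= (K * #|{ffun 'I_N -> 'I_k.+1}|%:R)%:E)%E.
Proof.
move=> n0 e0 Ne; apply: ge_ereal_sup => _ [E [finE [EY sepE]] <-]; rewrite lee_fin.
pose h (x : shspace k) := (word n x, word N (iter n (shift k) x)).
have hinj : set_inj E h.
  move=> x y /set_mem Ex /set_mem Ey [/wordP xy1 /wordP xy2]; apply: contrapT => xy.
  have := sepE x y Ex Ey xy; rewrite /bowen; apply/negP; rewrite -leNgt.
  apply/bigmax_leP; split=> [|i _]; first exact: ltW.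
  rewrite leNgt; apply/negP => /(sdist_gt e0 Ne)[j jN]; rewrite !iter_sshift => /eqP[].
  have [ijn|nij] := ltnP (i + j) n; first exact: xy1.
  have := xy2 (i + j - n)%N; rewrite !iter_sshift subnKC//; apply.
  by rewrite ltn_subLR// -addnS leq_add// ltnW.
apply: (@le_trans _ _ (\sum_(x \in E) K * law nu (@word k n) (h x).1)).
  rewrite !fsbig_finite// big_seq [leRHS]big_seq; apply: ler_sum => x.
  rewrite in_fset_set// inE => Ex; rewrite -pr_cyl -ler_pdivrMl//.
  by have /andP[] := nuG n0 (EY x Ex).
apply: (le_trans (sum_inj_le finE hinj (F := fun p => K * law nu (@word k n) p.1) _)).
  by move=> p; rewrite mulr_ge0 ?law_ge0// ltW.
rewrite -mulr_sumr ler_pM2l// -(pair_bigA _ (fun u _ => law nu (@word k n) u))/=.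
under eq_bigr do rewrite sumr_const -mulr_natr.
by rewrite -mulr_suml law_sum1 ?mul1r//; exact: fmeas_word.
Qed.

(** One representative per word of [Y] gives a separated set, since distinct words put the orbits at
    distance [1] at some time. The cylinders of these words cover [Y], which has mass [1]. *)
Lemma sepsum_ge n (e : R) : (0 < n)%N -> e < 1 -> ((K^-1)%:E <= sepsum Y G n e)%E.
Proof.
move=> n0 e1; pose S (w : {ffun 'I_n -> 'I_k.+1}) := `[< exists2 y : shspace k, Y y & word n y = w >].
have /choice[rep hrep] : forall w, exists y : shspace k, S w -> Y y /\ word n y = w.
  move=> w; have [[y Yy yw]|nw] := pselect (exists2 y : shspace k, Y y & word n y = w).
    by exists y.
  by exists point => /asboolP.
have inj : set_inj [set` S] rep.
  move=> u v /set_mem Su /set_mem Sv uv.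
  by have [_ <-] := hrep u Su; have [_ <-] := hrep v Sv; rewrite uv.
apply: (@le_trans _ _ (\sum_(x \in rep @` [set` S]) G n x)%:E); last first.
  apply: ereal_sup_ubound; exists (rep @` [set` S]) => //=; split.
    exact: finite_image.
  split=> [_ [w Sw <-]|_ _ [u Su <-] [v Sv <-] uv]; first by case: (hrep w Sw).
  have /ffunP/existsNP[i] : u <> v by move=> euv; apply: uv; rewrite euv.
  have repE w : S w -> w i = rep w i by move=> Sw; rewrite -{1}(hrep w Sw).2 ffunE.
  rewrite !repE// => /eqP uvi.
  apply: (lt_le_trans e1); rewrite /bowen; apply: le_trans (le_bigmax _ _ i).
  by rewrite sdist_head ?lexx// !iter_sshift addn0.
rewrite lee_fin (fsbig_image _ rep (G n) inj) -(bigfs _ (r := index_enum _)) ?index_enum_uniq//; last first.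
  by move=> i _ /negP[]; rewrite mem_index_enum.
apply: (@le_trans _ _ (\sum_(w | S w) K^-1 * law nu (@word k n) w)); last first.
  apply: ler_sum => w Sw; have [Yy <-] := hrep w Sw.
  rewrite -pr_cyl ler_pdivrMl//; have -> : G n (rep (word n (rep w))) = G n (rep w).
    by have [_ ->] := hrep w Sw.
  by have /andP[] := nuG n0 Yy.
have mw := @fmeas_word k n.
rewrite -mulr_sumr -pr_preimage//; apply: ler_peMr; first by rewrite invr_ge0 ltW.
have <- : pr nu Y = 1 by rewrite /pr nuY.
apply: le_pr.
- exact: subshift_measurable.
- exact: (fmeas_preimage [set` S]).
- by move=> y Yy; apply/asboolP; exists y.
Qed.

(** The separated sums lie between positive constants independent of [n], whose logarithms vanish
    after division by [n]. As this holds at every scale below [1], the limit in [e] is that of a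
    constant. *)
Lemma limn_esup_sepsum (e : R) : 0 < e < 1 ->
  limn_esup (fun n => ((n%:R)^-1)%:E * elog (sepsum Y G n e))%E = 0%E.
Proof.
move=> /andP[e0 e1].
have [N Ne] : exists N, 2^-1 ^+ N <= e.
  have := @cvg_expr R 2^-1; rewrite ger0_norm ?invr_ge0// invf_lt1// ltr1n => /(_ isT).
  move=> /cvgrPdist_le/(_ e e0)/filter_ex[N]; rewrite sub0r normrN => h; exists N.
  exact: le_trans (ler_norm _) h.
pose B := K * #|{ffun 'I_N -> 'I_k.+1}|%:R.
have B0 : 0 < B by rewrite mulr_gt0// ltr0n; apply/card_gt0P; exists [ffun=> ord0].
have bound n : (0 < n)%N -> (((n%:R)^-1 * - ln K)%:E <=
    ((n%:R)^-1)%:E * elog (sepsum Y G n e) <= ((n%:R)^-1 * ln B)%:E)%E.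
  move=> n0; have := sepsum_ge n0 e1; have := sepsum_le n0 e0 Ne.
  case: (sepsum Y G n e) => [r| |]//; rewrite !lee_fin => rB rK.
  have Ki : 0 < K^-1 by rewrite invr_gt0.
  have r0 : 0 < r by exact: lt_le_trans rK.
  rewrite /elog r0 -EFinM !lee_fin !ler_wpM2l// -?lnV ?posrE// ler_ln//.
have cK : ((n%:R)^-1 * - ln K)%:E @[n --> \oo] --> (0 : R)%:E.
  exact: cvg_comp (cvg_divn (- ln K)) _.
have cB : ((n%:R)^-1 * ln B)%:E @[n --> \oo] --> (0 : R)%:E.
  exact: cvg_comp (cvg_divn (ln B)) _.
have c : (fun n => ((n%:R)^-1)%:E * elog (sepsum Y G n e))%E @ \oo --> (0 : R)%:E.
  by apply: squeeze_cvge cK cB; exists 1%N.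
by have [_ ->] := cvg_limn_einf_sup c.
Qed.

Lemma comparable_pressure : pressure Y G = 0%E.
Proof.
apply/cvg_lim => //; apply: cvg_near_cst.
near=> e; apply: limn_esup_sepsum; apply/andP; split.
  by near: e; exact: nbhs_right_gt.
by near: e; exact: nbhs_right_lt.
Unshelve. all: by end_near.
Qed.

End zero_pressure.

(** * Cylinder estimates and ergodicity for the Gibbs measure on [X] *)

Section gibbs_submultiplicative.
Context (R : realType) (k : nat) (X : set (shsp k)) (f : potseq R k).
Variable mu : probability (shspace k) R.
Hypothesis sX : subshift X.
Hypothesis muI : invariant_on X mu.
Hypothesis fA : almost_additive X f.
Hypothesis gmu : gibbs X f mu.

Definition normalized n (x : shsp k) : R :=
  expR (- (n%:R * fine (pressure X f))) * f n x.

Lemma normalized_gt0 n x : (0 < n)%N -> X x -> 0 < normalized n x.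
Proof. by move=> n0 Xx; rewrite mulr_gt0 ?expR_gt0//; case: fA => + _; apply. Qed.

Lemma gibbs_bounds : exists2 D : R, 0 < D & forall n, (0 < n)%N -> forall x, X x ->
  D^-1 * normalized n x <= pr mu (cyl n x) <= D * normalized n x.
Proof.
have [C hC] := gmu.
(* A point of [X] is needed to see that the Gibbs constant is positive. *)
have [x0 Xx0] : X !=set0.
  apply/set0P/eqP => X0; case: muI => + _; rewrite X0 measure0 => /eqP.
  by rewrite eqe eq_sym oner_eq0.
exists C => [|n n0 x Xx].
  have /andP[_] := hC x0 Xx0 1%N isT; apply: le_lt_trans.
  by rewrite divr_ge0// ?pr_ge0// ltW// normalized_gt0.
have N0 := normalized_gt0 n0 Xx; have /andP[] := hC x Xx n n0.
by rewrite ltr_pdivlMr// ltr_pdivrMr// => h1 h2; rewrite !ltW.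
Qed.

Lemma normalized_quasi_mult : exists2 C : R, 0 < C & forall n p, (0 < n)%N -> (0 < p)%N ->
  forall x, X x ->
  C^-1 * (normalized n x * normalized p (iter n sshift x)) <= normalized (n + p) x
  <= C * (normalized n x * normalized p (iter n sshift x)).
Proof.
have [_ [_ [C C0 hC]]] := fA; exists (expR C) => [|n p n0 p0 x Xx]; first exact: expR_gt0.
have [h1 h2] := hC n p n0 p0 x Xx.
rewrite -expRN /normalized natrD mulrDl opprD expRD.
set a := expR (- (n%:R * _)); set b := expR (- (p%:R * _)).
have ab : 0 < a * b by rewrite mulr_gt0// expR_gt0.
have E (c u v : R) : c * (a * u * (b * v)) = a * b * (c * u * v) by ring.
by rewrite !E !ler_pM2l ?h1.
Qed.

Lemma subshift_iter n x : X x -> X (iter n sshift x).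
Proof. by case: sX => _ h Xx; elim: n => [//|n IH]; exact: h. Qed.

(** The upper bound holds at all sequences, because a cylinder of positive mass contains a point of
    [X]. The constant collects one [D] for the long cylinder, one for each piece, and [C] for the
    potential. *)
Lemma pr_cyl_quasi_mult : exists2 C : R, 0 < C & forall n p, (0 < n)%N -> (0 < p)%N ->
  (forall x : shsp k,
    pr mu (cyl (n + p) x) <= C * (pr mu (cyl n x) * pr mu (cyl p (iter n sshift x)))) /\
  (forall x, X x ->
    C^-1 * (pr mu (cyl n x) * pr mu (cyl p (iter n sshift x))) <= pr mu (cyl (n + p) x)).
Proof.
have [D D0 hD] := gibbs_bounds; have [C C0 hC] := normalized_quasi_mult.
exists (D * C * (D * D)); first by rewrite !mulr_gt0.
move=> n p n0 p0; have np0 : (0 < n + p)%N by rewrite addn_gt0 n0.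
split=> [x|x Xx]; last first.
  have Xs := subshift_iter n Xx.
  have /andP[_ a2] := hD n n0 x Xx; have /andP[_ b2] := hD p p0 _ Xs.
  have /andP[c1 _] := hD _ np0 x Xx; have /andP[d1 _] := hC n p n0 p0 x Xx.
  apply: le_trans c1.
  have -> : (D * C * (D * D))^-1 * (pr mu (cyl n x) * pr mu (cyl p (iter n sshift x))) =
    D^-1 * (C^-1 * ((D^-1 * pr mu (cyl n x)) * (D^-1 * pr mu (cyl p (iter n sshift x))))).
    by rewrite !invfM; ring.
  rewrite ler_pM2l ?invr_gt0//; apply: le_trans d1.
  rewrite ler_pM2l ?invr_gt0//; have Di : 0 <= D^-1 by rewrite invr_ge0 ltW.
  apply: ler_pM.
  - by rewrite mulr_ge0// pr_ge0.
  - by rewrite mulr_ge0// pr_ge0.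
  - by rewrite ler_pdivrMl.
  - by rewrite ler_pdivrMl.
have [pz|] := ltP 0 (pr mu (cyl (n + p) x)); last first.
  move=> /le_trans; apply; rewrite !mulr_ge0 ?pr_ge0 ?ltW//.
rewrite pr_cyl in pz; have [z Xz /wordP zx] := law_word_gt0 sX muI.1 pz.
have e1 : cyl (n + p) x = cyl (n + p) z by rewrite !cylE (_ : word (n + p) x = word (n + p) z)//; apply/wordP => i ni; rewrite zx.
have e2 : cyl n x = cyl n z.
  rewrite !cylE (_ : word n x = word n z)//; apply/wordP => i ni.
  by rewrite zx// (leq_trans ni)// leq_addr.
have e3 : cyl p (iter n sshift x) = cyl p (iter n sshift z).
  rewrite !cylE (_ : word p _ = word p (iter n sshift z))//; apply/wordP => i ni.
  by rewrite !iter_sshift zx// ltn_add2l.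
rewrite e1 e2 e3; have Xs := subshift_iter n Xz.
have /andP[a1 _] := hD n n0 z Xz; have /andP[b1 _] := hD p p0 _ Xs.
have /andP[_ c2] := hD _ np0 z Xz; have /andP[_ d2] := hC n p n0 p0 z Xz.
apply: (le_trans c2); rewrite -!mulrA ler_pM2l//; apply: (le_trans d2).
rewrite ler_pM2l//.
have -> : D * (D * (pr mu (cyl n z) * pr mu (cyl p (iter n sshift z)))) =
  (D * pr mu (cyl n z)) * (D * pr mu (cyl p (iter n sshift z))) by ring.
have N1 := normalized_gt0 n0 Xz; have N2 := normalized_gt0 p0 Xs.
by apply: ler_pM; rewrite ?(ltW N1) ?(ltW N2)// -ler_pdivrMl.
Qed.

(** Each further letter multiplies the mass by at least [C^-1 * d], with [d] the least positive mass
    of a one-letter word; taking the minimum with [d] covers length one. *)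
Lemma pr_cyl_exp_lower : exists2 c : R, 0 < c & forall n, (0 < n)%N -> forall x, X x ->
  c ^+ n <= pr mu (cyl n x).
Proof.
have [D D0 hD] := gibbs_bounds; have [C C0 hC] := pr_cyl_quasi_mult.
pose L := law mu (@word k 1).
pose d : R := \big[Num.min/1]_(w | 0 < L w) L w.
have d0 : 0 < d by apply/bigmin_gtP; split.
have dle x : X x -> d <= pr mu (cyl 1 x).
  move=> Xx; rewrite pr_cyl; apply: bigmin_le_cond.
  rewrite /L -pr_cyl; have /andP[h _] := hD 1%N isT x Xx.
  by apply: lt_le_trans h; rewrite mulr_gt0 ?invr_gt0// normalized_gt0.
pose c := Num.min d (C^-1 * d).
have c0 : 0 < c by rewrite lt_min d0 mulr_gt0// invr_gt0.
exists c => // -[//|n] _; elim: n => [|n IH] x Xx.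
  by rewrite expr1; apply: le_trans (dle x Xx); rewrite ge_min lexx.
have [_ /(_ x Xx) h] := hC 1%N n.+1 isT isT; rewrite add1n in h.
apply: le_trans h; rewrite mulrA exprS; apply: ler_pM.
- exact: ltW.
- by rewrite exprn_ge0// ltW.
- apply: (@le_trans _ _ (C^-1 * d)); first by rewrite ge_min lexx orbT.
  by rewrite ler_pM2l ?invr_gt0//; exact: dle.
- by apply: IH; case: sX => _; exact.
Qed.

Lemma gibbs_ergodic : (forall m, invariant_on X m -> gibbs X f m -> same_measure m mu) ->
  forall B : set (shspace k), measurable B -> shift k @^-1` B = B ->
  pr mu B = 0 \/ pr mu B = 1.
Proof.
move=> uniq B mB BI; have [muX mI] := muI.
pose b := pr mu B; have b0 : 0 <= b by exact: pr_ge0.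
have b1 : b <= 1 by exact: pr_le1.
have [m mE] : exists m : probability (shspace k) R, forall A, measurable A ->
    m A = ((pr mu A + pr mu (A `&` B)) / (1 + b))%:E.
  (* The last argument of [mnormalize] is a fallback for total mass zero or infinity; here the mass
     is [1 + b]. *)
  exists (mnormalize (measure_add mu (mrestr mu mB)) mu) => A mA.
  have hT : measure_add mu (mrestr mu mB) setT = (1 + b)%:E.
    rewrite measure_addE; change (mu setT + mu (setT `&` B) = (1 + b)%:E)%E.
    by rewrite setTI probability_setT EFinD prE.
  transitivity (let e := measure_add mu (mrestr mu mB) setT in
      if (e == 0) || (e == +oo) then mu A
      else measure_add mu (mrestr mu mB) A * ((fine e)^-1)%:E)%E.
    by rewrite /= /mnormalize; case: ifP.
  rewrite hT /= eqe gt_eqF; last by rewrite ltr_wpDr.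
  have mAB := measurableI A B mA mB.
  rewrite /= measure_addE; change ((mu A + mu (A `&` B)) * ((1 + b)^-1)%:E =
    ((pr mu A + pr mu (A `&` B)) / (1 + b))%:E)%E.
  by rewrite -(prE mu mA) -(prE mu mAB) -EFinD -EFinM.
have prmE A : measurable A -> pr m A = (pr mu A + pr mu (A `&` B)) / (1 + b).
  by move=> mA; rewrite /pr mE.
have b10 : 0 < 1 + b by rewrite ltr_wpDr.
have same : same_measure m mu.
  apply: uniq; first split.
  - rewrite mE; last exact: subshift_measurable.
    rewrite [X `&` B]setIC pr_setI_full// [pr mu X]/pr muX /= divff//.
    by rewrite gt_eqF.
  - move=> A mA; rewrite !mE//; last exact: measurable_sshift.
    congr (((_ + _) / _)%:E); rewrite /pr; first by rewrite mI.
    by rewrite -{1}BI -preimage_setI mI//; exact: measurableI.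
  (* The unnormalized mass lies between [mu] and [2 mu], and [1 <= 1 + b <= 2], so doubling the
     Gibbs constant is enough. *)
  have [C hC] := gmu; exists (C + C) => x Xx n n0.
  have /andP[h1 h2] := hC x Xx n n0.
  have N0 := normalized_gt0 n0 Xx; rewrite -/(normalized n x) in h1 h2 *.
  have mc := measurable_cyl n x.
  have C0 : 0 < C by apply: le_lt_trans h2; rewrite divr_ge0 ?pr_ge0// ltW.
  rewrite -/(pr m _) prmE//; move: h1 h2; rewrite -/(pr mu _).
  rewrite !ltr_pdivlMr// !ltr_pdivrMr// => h1 h2.
  set q := pr mu _ in h1 h2 *; set s := pr mu _.
  have s0 : 0 <= s by exact: pr_ge0.
  have sq : s <= q by apply: le_pr => //; exact: measurableI.
  have CC : (C + C)^-1 = C^-1 / 2 by rewrite -[C + C]mulr2n -[C *+ 2]mulr_natr invfM mulrC.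
  rewrite CC; apply/andP; split.
    have := h1; set N := normalized n x in N0 *.
    have CN0 : 0 < C^-1 * N by rewrite mulr_gt0// invr_gt0.
    have -> : C^-1 / 2 * N * (1 + b) = C^-1 * N * ((1 + b) / 2) by ring.
    have : C^-1 * N * ((1 + b) / 2) <= C^-1 * N by rewrite ger_pMr//; lra.
    lra.
  rewrite [(C + C) * _]mulrDl.
  have CN0 : 0 < C * normalized n x by rewrite mulr_gt0.
  have : C * normalized n x + C * normalized n x <= (C * normalized n x + C * normalized n x) * (1 + b).
    by rewrite ler_peMr ?lerDl// addr_ge0// ltW.
  lra.
(* At [B] the equality of measures reads [2 b / (1 + b) = b]. *)
have := prmE B mB; rewrite /pr same// -/(pr mu B) -/b setIid => e.
have e2 : b * (1 + b) = b + b by rewrite {1}e divfK// gt_eqF.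
have /eqP : b * (b - 1) = 0 by move: e2; rewrite mulrDr mulrBr !mulr1; lra.
by rewrite mulf_eq0 subr_eq0 => /orP[/eqP|/eqP]; [left|right].
Qed.

End gibbs_submultiplicative.

(** * Transfer of the estimates to the factor *)

Section factor.
Context (R : realType) (k l : nat) (X : set (shsp k)) (Y : set (shsp l)).
Variables (phi : 'I_k.+1 -> 'I_l.+1) (f : potseq R k).
Variables (mu : probability (shspace k) R) (nu : probability (shspace l) R).
Hypothesis sX : subshift X.
Hypothesis sY : subshift Y.
Hypothesis fac : one_block_factor X Y phi.
Hypothesis muI : invariant_on X mu.
Hypothesis fA : almost_additive X f.
Hypothesis gmu : gibbs X f mu.
Hypothesis nuE : forall B : set (shspace l), measurable B ->
  nu B = mu (one_block phi @^-1` B).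

Local Notation proj := (one_block phi : shspace k -> shspace l).

Definition word_map n (w : {ffun 'I_n -> 'I_k.+1}) : {ffun 'I_n -> 'I_l.+1} :=
  [ffun i => phi (w i)].

Lemma word_proj n x : word n (proj x) = word_map (word n x).
Proof. by apply/ffunP => i; rewrite !ffunE. Qed.

Lemma measurable_proj (B : set (shspace l)) :
  measurable B -> measurable (proj @^-1` B).
Proof.
elim/shspace_ind => [n x| |A mA|F mF].
- apply: (@local_measurable k n) => y z yz /= xy i ni.
  by rewrite -xy// /one_block yz.
- by rewrite preimage_set0; exact: measurable0.
- by rewrite preimage_setC; exact: measurableC.
- by rewrite preimage_bigcup; exact: bigcup_measurable.
Qed.

Lemma pr_nuE (B : set (shspace l)) : measurable B -> pr nu B = pr mu (proj @^-1` B).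
Proof. by move=> mB; rewrite /pr nuE. Qed.

Lemma factor_invariant : invariant_on Y nu.
Proof.
have [muX mI] := muI; have [XY _] := fac.
have mY := subshift_measurable sY; have mX := subshift_measurable sX.
split=> [|A mA]; last first.
  rewrite !nuE//; last exact: measurable_sshift.
  by rewrite -[in RHS]mI//; exact: measurable_proj.
apply/eqP; rewrite eq_le probability_le1// nuE// -[leLHS]muX.
by apply: le_measure; rewrite ?inE//; exact: measurable_proj.
Qed.

Lemma law_nuE n u : law nu (@word l n) u =
  \sum_(w | word_map w == u) law mu (@word k n) w.
Proof.
rewrite -(law_comp mu (@word_map n) u (@fmeas_word k n)) /law pr_nuE; last exact: fmeas_word.
by congr (pr mu _); apply/seteqP; split => x /=; rewrite word_proj.
Qed.

Lemma sum_pred_inj_le (I J : finType) (h : J -> I) (P : pred J) (Q : pred I)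
    (F : I -> R) : {in P &, injective h} -> (forall j, P j -> Q (h j)) ->
  (forall i, 0 <= F i) -> \sum_(j | P j) F (h j) <= \sum_(i | Q i) F i.
Proof.
move=> hinj PQ F0.
rewrite (eq_bigr (fun j => F (h j))) // -(big_imset (h := h) (A := P) F)//=.
rewrite [leLHS]big_mkcond [leRHS]big_mkcond; apply: ler_sum => i _.
case: imsetP => [[j Pj ->]|_]; last by case: ifP.
by rewrite PQ.
Qed.

(** Cutting a preimage word at [n] is injective, so the sum over preimages of the long word is
    dominated by the product of the sums for its pieces. There is no converse: two charged words
    need not concatenate to a charged one. *)
Lemma factor_submul : exists2 C : R, 0 < C & forall n p, (0 < n)%N -> (0 < p)%N ->
  forall y : shsp l,
    pr nu (cyl (n + p) y) <= C * (pr nu (cyl n y) * pr nu (cyl p (iter n sshift y))).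
Proof.
have [C C0 hC] := pr_cyl_quasi_mult sX muI fA gmu; exists C => // n p n0 p0 y.
rewrite !pr_cyl !law_nuE.
pose h (w : {ffun 'I_(n + p) -> 'I_k.+1}) :=
  (word n (pad w), word p (iter n (shift k) (pad w))).
have hinj : injective h.
  move=> w w' [/wordP e1 /wordP e2]; rewrite -(word_pad w) -(word_pad w').
  apply/wordP => i inp; have [ijn|nij] := ltnP i n; first exact: e1.
  have := e2 (i - n)%N; rewrite !iter_sshift subnKC//; apply.
  by rewrite ltn_subLR.
rewrite big_distrlr/= pair_big/= mulr_sumr.
apply: (@le_trans _ _ (\sum_(w | word_map w == word (n + p) y)
    C * (law mu (@word k n) (h w).1 * law mu (@word k p) (h w).2))).
  apply: ler_sum => w _; rewrite -{1}(word_pad w) -!pr_cyl.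
  by have [/(_ (pad w))] := hC n p n0 p0.
apply: (sum_pred_inj_le (h := h) (F := fun q => C * (law mu (@word k n) q.1 * law mu (@word k p) q.2))).
- by move=> ? ? _ _; exact: hinj.
- move=> w /eqP wy /=.
  have key : agree (n + p) (proj (pad w)) y by apply/wordP; rewrite word_proj word_pad.
  apply/andP; split; apply/eqP; rewrite -word_proj; apply/wordP => i ni.
    exact: key (ltn_addr p ni).
  by rewrite iter_sshift -key ?ltn_add2l// /one_block iter_sshift.
- by move=> q; apply: mulr_ge0; [exact: ltW|rewrite mulr_ge0 ?law_ge0].
Qed.

Lemma factor_exp_lower : exists2 c : R, 0 < c & forall n, (0 < n)%N ->
  forall y, Y y -> c ^+ n <= pr nu (cyl n y).
Proof.
have [c c0 hc] := pr_cyl_exp_lower sX muI fA gmu; exists c => // n n0 y.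
have [_ /[apply] -[x Xx <-]] := fac; apply: le_trans (hc n n0 x Xx) _.
rewrite pr_nuE; last exact: measurable_cyl.
apply: le_pr; [exact: measurable_cyl|apply: measurable_proj; exact: measurable_cyl|].
by move=> z zx i ni; rewrite /one_block zx.
Qed.

Lemma En_finite n y E : En X phi n y E -> set_inj E (@word k n) /\ finite_set E.
Proof.
move=> [EX hE]; have inj : set_inj E (@word k n).
  move=> x x' /set_mem Ex /set_mem Ex' /wordP e; have [Xx xy] := EX x Ex.
  have [z [_ _ uz]] := hE x Xx xy.
  by rewrite (uz x Ex (fun _ _ => erefl)) (uz x' Ex' (fun i ni => esym (e i ni))).
split=> //; rewrite -(eq_finite_set (inj_card_eq inj)); exact: finite_finset.
Qed.

(** [E] meets each cylinder of [X] above the word of [y] exactly once, and words without a point of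
    [X] are [mu]-null. *)
Lemma pr_nu_En n (y : shspace l) E : En X phi n y E ->
  \sum_(x \in E) pr mu (cyl n x) = pr nu (cyl n y).
Proof.
move=> hE; have [inj finE] := En_finite hE; have [EX uE] := hE.
rewrite pr_cyl law_nuE.
under eq_fsbigr do rewrite pr_cyl.
rewrite -(fsbig_image E (@word k n) (law mu (@word k n)) inj).
pose P w := `[< (@word k n @` E) w >].
have -> : @word k n @` E = [set` P] by apply/seteqP; split => i /=; [move/asboolP|move/asboolP].
rewrite -(bigfs _ (r := index_enum _)) ?index_enum_uniq//; last first.
  by move=> i _ /negP[]; rewrite mem_index_enum.
rewrite [LHS]big_mkcond [RHS]big_mkcond; apply: eq_bigr => w _; rewrite /P.
have [pw|] := ltP 0 (law mu (@word k n) w); last first.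
  move=> p0; have -> : law mu (@word k n) w = 0 by apply/eqP; rewrite eq_le p0 law_ge0.
  by rewrite !if_same.
have [x Xx xw] := law_word_gt0 sX muI.1 pw; congr (if _ then _ else _).
apply/asboolP/eqP => [[z Ez <-]|wy].
  by rewrite -word_proj; apply/wordP => i ni; have [_] := EX z Ez; apply.
have xy i : (i < n)%N -> phi (x i) = y i.
  by move: wy; rewrite -xw -word_proj => /wordP; apply.
have [z [Ez zx _]] := uE x Xx xy; exists z => //.
by rewrite -xw; apply/wordP => i ni; rewrite zx.
Qed.

Lemma En_exists n y : exists E, En X phi n y E.
Proof.
have /choice[r hr] : forall w : {ffun 'I_n -> 'I_k.+1}, exists x : shspace k,
    (exists2 z, X z & word n z = w) -> X x /\ word n x = w.
  move=> w; have [[x Xx xw]|nw] := pselect (exists2 z, X z & word n z = w).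
    by exists x.
  by exists point.
exists [set x | [/\ X x, forall i, (i < n)%N -> phi (x i) = y i & r (word n x) = x]].
split=> [x [Xx xy _]//|x Xx xy].
have [Xr rw] : X (r (word n x)) /\ word n (r (word n x)) = word n x by apply: hr; exists x.
exists (r (word n x)); split.
- split=> // [i ni|]; last by rewrite rw.
  by rewrite -xy//; congr phi; move/wordP: rw; apply.
- by move/wordP: rw.
- by move=> z [_ _ ez] /wordP zx; rewrite -{1}ez zx.
Qed.

(** For every choice of [E] the Gibbs bounds summed over [E] frame the same number, the [nu]-mass of
    the cylinder, so they pass to the supremum. *)
Lemma gtilde_bounds : exists2 D : R, 0 < D & forall n, (0 < n)%N -> forall y : shspace l,
  D^-1 * gtilde X phi f n y <= pr nu (cyl n y) <= D * gtilde X phi f n y.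
Proof.
have [D D0 hD] := gibbs_bounds muI fA gmu; exists D => // n n0 y.
pose e := expR (- (n%:R * fine (pressure X f))).
have e0 : 0 < e by exact: expR_gt0.
pose S := [set \sum_(x \in E) f n x | E in En X phi n y].
have SE E : En X phi n y E ->
    D^-1 * ((\sum_(x \in E) f n x) * e) <= pr nu (cyl n y) <= D * ((\sum_(x \in E) f n x) * e).
  move=> hE; have [_ finE] := En_finite hE; have [EX _] := hE.
  rewrite -(pr_nu_En hE) !fsbig_finite//= mulr_suml !mulr_sumr.
  apply/andP; split; rewrite big_seq [leRHS]big_seq; apply: ler_sum => x;
    rewrite in_fset_set// inE => /EX[Xx _];
    by have /andP[] := hD n n0 x Xx; rewrite /normalized [_ * f n x]mulrC.
have [E0 hE0] := En_exists n y.
have S0 : S !=set0 by exists (\sum_(x \in E0) f n x), E0.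
(* The lower Gibbs bound also shows that the sums are bounded above, without which [sup] would carry
   no information. *)
have ubS : ubound S (D * pr nu (cyl n y) / e).
  move=> _ [E hE <-]; have /andP[h _] := SE E hE.
  by rewrite ler_pdivlMr// -ler_pdivrMl.
rewrite /gtilde /gseq -/S -/e; apply/andP; split.
  by rewrite ler_pdivrMl// -ler_pdivlMr//; exact: ge_sup.
have /andP[_ h] := SE E0 hE0; apply: (le_trans h).
rewrite ler_pM2l// ler_pM2r//; apply: ub_le_sup; last by exists E0.
by exists (D * pr nu (cyl n y) / e).
Qed.

Lemma En_local n (y y' : shspace l) E : agree n y y' ->
  En X phi n y E -> En X phi n y' E.
Proof.
move=> yy [EX hE]; split=> [x /EX[Xx xy]|x Xx xy].
  by split=> // i ni; rewrite xy// yy.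
by apply: hE => // i ni; rewrite xy// yy.
Qed.

Lemma gtilde_local n (y y' : shspace l) : agree n y y' ->
  gtilde X phi f n y = gtilde X phi f n y'.
Proof.
move=> yy; rewrite /gtilde /gseq (_ : En X phi n y = En X phi n y')//.
by apply/funext => E; apply/propext; split; apply: En_local => //; exact: agree_sym.
Qed.

End factor.

Theorem theorem3p7 (R : realType) (k l : nat)
    (X : set (shsp k)) (Y : set (shsp l)) (phi : 'I_k.+1 -> 'I_l.+1)
    (f : potseq R k)
    (mu : probability (shspace k) R) (nu : probability (shspace l) R) :
  subshift X -> subshift Y -> one_block_factor X Y phi -> specification X ->
  almost_additive X f -> bdd_variation X f ->
  (* mu is the unique invariant Gibbs measure for F, which is its unique
     equilibrium state *)
  invariant_on X mu -> gibbs X f mu ->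
  (forall m, invariant_on X m -> gibbs X f m -> same_measure m mu) ->
  equilibrium X f mu ->
  (forall m, equilibrium X f m -> same_measure m mu) ->
  (* nu = pi mu *)
  (forall B : set (shspace l), measurable B ->
     nu B = mu (one_block phi @^-1` B)) ->
  [/\ pressure Y (gtilde X phi f) = 0%E,
      invariant_on Y nu /\ gibbs Y (gtilde X phi f) nu,
      (forall m, invariant_on Y m -> gibbs Y (gtilde X phi f) m -> same_measure m nu),
      equilibrium Y (gtilde X phi f) nu &
      (forall m, equilibrium Y (gtilde X phi f) m -> same_measure m nu)].
Proof.
move=> sX sY fac _ fA _ muI gmu uniq _ _ nuE.
have nuI := factor_invariant sX sY fac muI nuE.
have [C C0 hC] := factor_submul sX muI fA gmu nuE.
have [c c0 hc] := factor_exp_lower sX fac muI fA gmu nuE.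
have [D D0 hD] := gtilde_bounds sX muI fA gmu nuE.
(* The single constant [D + C] dominates both that of the comparison with [gtilde] and that of
   submultiplicativity. *)
have DK : D <= D + C by rewrite lerDl ltW.
have K0 : 0 < D + C by rewrite addr_gt0.
have nuG n : (0 < n)%N -> forall y, Y y ->
    (D + C)^-1 * gtilde X phi f n y <= pr nu (cyl n y) <= (D + C) * gtilde X phi f n y.
  move=> n0 y _; have /andP[h1 h2] := hD n n0 y.
  have g0 : 0 <= gtilde X phi f n y.
    by rewrite -(pmulr_rge0 _ D0); apply: le_trans h2; exact: pr_ge0.
  apply/andP; split; last by apply: (le_trans h2); exact: ler_wpM2r.
  apply: le_trans h1; apply: ler_wpM2r => //.
  by rewrite lef_pV2 ?posrE.
have nu_submul n p : (0 < n)%N -> (0 < p)%N -> forall y : shsp l,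
    pr nu (cyl (n + p) y) <= (D + C) * (pr nu (cyl n y) * pr nu (cyl p (iter n sshift y))).
  move=> n0 p0 y; apply: (le_trans (hC n p n0 p0 y)); apply: ler_wpM2r.
    by rewrite mulr_ge0 ?pr_ge0.
  by rewrite lerDr ltW.
have erg (A : set (shspace l)) : measurable A -> shift l @^-1` A = A ->
    pr nu A = 0 \/ pr nu A = 1.
  (* The preimage of an invariant set under the factor map is invariant, so ergodicity descends from
     [mu] to [nu]. *)
  move=> mA AI; rewrite (pr_nuE nuE mA).
  apply: (gibbs_ergodic sX muI fA gmu uniq (measurable_proj phi mA)).
  by rewrite -{2}AI.
have Gloc := @gtilde_local R k l X phi f.
have P0 := comparable_pressure sY nuI.1 K0 nuG.
split=> //.
- by split=> //; exact: (comparable_gibbs K0 c0 nuG hc P0).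
- move=> m; exact: (gibbs_unique sY nuI K0 c0 nuG hc Gloc erg P0).
- exact: (comparable_equilibrium sY nuI K0 c0 nuG hc nu_submul Gloc).
- move=> m; exact: (equilibrium_unique sY nuI K0 c0 nuG hc nu_submul Gloc erg).
Qed.
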